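(* Let $\mathbf{u} = (u(n))_{n=1}^\infty$ be a simple non-degenerate integer linear recurrence sequence of order $d \ge 2$. For any fixed integer $s \ge 1$, uniformly over integers $M \ge 0$, we have \[ \mathsf{M}_s^*(M,N) \le N^{s\left(1 - 1/(4d-3)\right) + o(1)}, \] where $o(1)$ denotes a quantity tending to $0$ as $N \to \infty$ at a rate depending only on $s$ and $\mathbf{u}$ (and not on $M$). That is, for every $\varepsilon > 0$ there is $N_0 = N_0(\varepsilon, s, \mathbf{u})$ such that $\mathsf{M}_s^*(M,N) \le N^{s(1-1/(4d-3)) + \varepsilon}$ for all integers $N \ge N_0$ and all integers $M \ge 0$.
   Context: An integer linear recurrence sequence of order $d \ge 1$ is a sequence of integers $\mathbf{u} = (u(n))_{n=1}^\infty$ satisfying a relation $u(n+d) = c_{d-1}u(n+d-1) + \cdots + c_0 u(n)$ for all $n = 1, 2, \ldots$, with integer coefficients $c_0, \ldots, c_{d-1}$, and not satisfying any shorter relation of this form. Its characteristic polynomial is $f(X) = X^d - c_{d-1}X^{d-1} - \cdots - c_0 \in \mathbb{Z}[X]$. The sequence is non-degenerate if there are no roots of unity among the ratios of distinct (complex) roots of $f$; here it is understood that these ratios are defined, i.e. $c_0 \ne 0$. The sequence is simple if $f$ has no multiple roots. Nonzero complex numbers $\gamma_1, \ldots, \gamma_s$ are multiplicatively dependent if there exist integers $k_1, \ldots, k_s$, not all zero, such that $\gamma_1^{k_1} \cdots \gamma_s^{k_s} = 1$. They are multiplicatively dependent of maximal rank if they are multiplicatively dependent and no proper (nonempty) sub-tuple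 of $(\gamma_1, \ldots, \gamma_s)$ is multiplicatively dependent. For integers $M \ge 0$, $N \ge 1$, $s \ge 1$, $\mathsf{M}_s^*(M,N)$ denotes the number of $s$-tuples $(n_1, \ldots, n_s) \in (\mathbb{Z} \cap [M+1, M+N])^s$ such that $u(n_1), \ldots, u(n_s)$ (all nonzero) are multiplicatively dependent of maximal rank. *)

(* Defs.v *)
From HB Require Import structures.
From mathcomp Require Import all_boot all_order all_algebra.
From mathcomp Require Import boolp.

Set Implicit Arguments.
Unset Strict Implicit.
Unset Printing Implicit Defensive.

Import Order.TTheory GRing.Theory Num.Theory.
Import UnityRootTheory.

Local Open Scope ring_scope.

(* A sequence (u(n))_{n >= 1} is a function on nat whose value at 0 is never
   used; likewise only c 0, ..., c (d - 1) matter in a recurrence of order d. *)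
Definition satisfies_recurrence (u : nat -> int) (d : nat) (c : nat -> int) :=
  forall n : nat, (1 <= n)%N -> u (n + d)%N = \sum_(i < d) c i * u (n + i)%N.

Definition linear_recurrence (u : nat -> int) (d : nat) (c : nat -> int) :=
  [/\ (1 <= d)%N, satisfies_recurrence u d c &
      forall (e : nat) (b : nat -> int),
        (1 <= e < d)%N -> ~ satisfies_recurrence u e b].

Definition recurrence_poly (d : nat) (c : nat -> int) : {poly int} :=
  'X^d - \sum_(i < d) c i *: 'X^i.

Section Complex.
Variable C : closedFieldType.

Definition complex_recurrence_poly (d : nat) (c : nat -> int) : {poly C} :=
  map_poly intr (recurrence_poly d c).

Definition simple_recurrence (d : nat) (c : nat -> int) :=
  forall x : C, (mup x (complex_recurrence_poly d c) <= 1)%N.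

Definition nondegenerate_recurrence (d : nat) (c : nat -> int) :=
  c 0%N != 0 /\
  forall x y : C,
    root (complex_recurrence_poly d c) x ->
    root (complex_recurrence_poly d c) y ->
    x != y ->
    forall m : nat, (0 < m)%N -> ~~ m.-unity_root (x / y).

Definition mult_dependent (I : finType) (g : I -> C) :=
  (forall i, g i != 0) /\
  exists k : I -> int, (exists i, k i != 0) /\ \prod_i g i ^ k i = 1.

(* Sub-tuples are taken with respect to index sets A, so that a tuple with
   repeated entries has the pair of equal entries among its sub-tuples. *)
Definition mult_dependent_max_rank (I : finType) (g : I -> C) :=
  mult_dependent g /\
  forall A : {set I}, A != set0 -> A \proper [set: I] ->
    ~ mult_dependent (fun i : {i | i \in A} => g (val i)).

Definition count_max_rank (u : nat -> int) (s M N : nat) : nat :=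
  #|[set n : {ffun 'I_s -> 'I_(M + N).+1} |
      [forall i, (M + 1 <= n i)%N] &&
      `[< mult_dependent_max_rank (fun i => (u (n i))%:~R) >] ]|.

End Complex.

(* Main.v *)
(* Write u(n) through the companion matrix A of the recurrence, and for times
   h_1, ..., h_d let D(h) be the determinant of the system giving the state at x
   from u(x + h_1), ..., u(x + h_d).

   - A p-adic (Skolem type) argument, carried out with finite differences modulo
     p, shows that any N^o(1) times in an interval of length N contain d times
     with D(h) <> 0.  Hence a prime p not dividing D(h), for h in [0, H)^d, det A
     and the initial Hankel determinant ("good" prime) divides at most N^o(1) of
     any H consecutive terms; there are O(H^d) bad primes.
   - The powers of A, divided by their content, grow exponentially: otherwise, by
     Gauss's lemma and Kronecker's theorem, the ratios of the roots would be roots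
     of unity.  So all but few u(n) have an exponentially large part prime to
     det A, and comparing with the valuations allowed by the determinants D(h)
     only H^d N^o(1) of N consecutive terms have all their primes bad.
   - A dependence of maximal rank is a linear relation with nonzero coefficients
     between the valuation vectors of u(n_1), ..., u(n_s) at good primes.
     Exploring the indices along such a relation, each freely chosen index with a
     nonzero vector is followed by one whose term must be divisible by one of at
     most s known good primes, which leaves N^(1+o(1)) / H choices for it.

   With H = N^(2/(4d-3)) each index gains N^(1/(4d-3)) on average. *)
Require Import Defs.
From mathcomp Require Import all_boot all_order all_algebra.
From mathcomp Require Import perm boolp.
From mathcomp Require Import reals exp complex.
From mathcomp Require Import zify ring lra.

Set Implicit Arguments.
Unset Strict Implicit.
Unset Printing Implicit Defensive.

Import Order.TTheory GRing.Theory Num.Theory.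
Import UnityRootTheory.

Local Open Scope ring_scope.
Local Open Scope complex_scope.

(** * Companion matrices and their spectrum *)

(** An N^o(1) is always a number K with [K ^ t <= c0 * N] for a fixed t, chosen only at the end from
    s and eps. It comes from a prime p > (d - 1)^t: each p-adic digit leaves at most d - 1 residue
    classes that can contain a zero, so p^j terms of a suitable progression contain at most (d -
    1)^j <= p^(j / t) zeros. The bound has to be uniform in the initial vector, because it is
    applied to a kernel vector of unknown size. Times are measured from the start x of a window and
    D(h) does not involve x; this is the source of uniformity in M. The main obstacle is the primes
    dividing det A: A is not invertible modulo them, so divisibility by them does not pass to D(h),
    and a priori they could make up all of u(n). Hence the comparison of size and content of A^n:
    what divides d independent terms nearly divides A^n. Kronecker's theorem needs integrality of
    the normalised eigenvalues; when it fails, Gauss's lemma along repeated squarings of the roots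
    bounds the content instead. *)

Definition shift_mx (R : pzRingType) (d : nat) (c : nat -> R) : 'M[R]_d :=
  \matrix_(i, j) if i.+1 == d then c j else (j == i.+1 :> nat)%:R.

Definition vander (R : pzRingType) (d : nat) (al : 'I_d -> R) : 'M[R]_d :=
  \matrix_(i, j) al j ^+ i.

Lemma map_shift_mx (R S : pzRingType) (f : {rmorphism R -> S}) d (c : nat -> R) :
  map_mx f (shift_mx d c) = shift_mx d (f \o c).
Proof.
apply/matrixP=> i j; rewrite !mxE /=.
by case: ifP => _ //; rewrite rmorph_nat.
Qed.

Lemma map_mxXn (R S : pzRingType) (f : {rmorphism R -> S}) d (A : 'M[R]_d) n :
  map_mx f (A ^+ n) = map_mx f A ^+ n.
Proof.
elim: n => [|n IHn]; first by rewrite !expr0 -[1]/(1%:M) map_mx1.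
by rewrite !exprS -[LHS]/(map_mx f (A *m A ^+ n)) map_mxM IHn.
Qed.

Lemma shift_mxE (R : pzRingType) d (c : nat -> R) (w : 'cV[R]_d.+1) (i : 'I_d.+1) :
  (shift_mx d.+1 c *m w) i 0 =
  if (i < d)%N then w (inord i.+1) 0 else \sum_(j < d.+1) c j * w j 0.
Proof.
rewrite mxE; have [ltid|] := ltnP i d.
  rewrite (bigD1 (inord i.+1)) //= mxE inordK ?ltnS //.
  rewrite eqSS ltn_eqF // eqxx mul1r big1 ?addr0 // => j /eqP nj.
  rewrite mxE eqSS ltn_eqF //; case: eqP => [e|]; last by rewrite mul0r.
  by case: nj; apply/val_inj; rewrite /= inordK ?ltnS.
move=> ledi; have {ledi} -> : i = ord_max by apply/val_inj/eqP; rewrite eqn_leq ledi -ltnS ltn_ord.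
by apply: eq_bigr => j _; rewrite mxE /= eqxx.
Qed.

Section Spectral.
Variables (F : fieldType) (d' : nat).
Let d := d'.+1.
Variables (c : nat -> F) (al : 'I_d -> F).
Hypothesis al_root : forall j, al j ^+ d = \sum_(i < d) c i * al j ^+ i.
Hypothesis al_inj : injective al.

Lemma vander_unit : vander al \in unitmx.
Proof.
have -> : vander al = Vandermonde d (\row_j al j).
  by apply/matrixP=> i j; rewrite !mxE.
rewrite unitmxE det_Vandermonde unitfE; apply/prodf_neq0 => i _.
apply/prodf_neq0 => j ltij; rewrite !mxE subr_eq0.
by apply: contraTneq ltij => /al_inj->; rewrite ltnn.
Qed.

Lemma shift_vander :
  shift_mx d c *m vander al = vander al *m diag_mx (\row_j al j).
Proof.
apply/matrixP=> i j; rewrite mul_mx_diag !mxE -exprSr.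
have -> : \sum_k shift_mx d c i k * vander al k j = (shift_mx d c *m col j (vander al)) i 0.
  by rewrite mxE; apply: eq_bigr => k _; rewrite !mxE.
rewrite shift_mxE; case: ltnP => [lt|le].
  by rewrite !mxE inordK.
have -> : val i = d' by apply/eqP; rewrite eqn_leq le -ltnS ltn_ord.
by rewrite al_root; apply: eq_bigr => k _; rewrite !mxE.
Qed.

Lemma shiftX_vander n :
  shift_mx d c ^+ n *m vander al = vander al *m diag_mx (\row_j al j ^+ n).
Proof.
elim: n => [|n IHn].
  rewrite expr0 mul1mx; apply/matrixP=> i j.
  by rewrite mul_mx_diag !mxE expr0 mulr1.
rewrite exprS -[X in X *m _]/(shift_mx d c *m shift_mx d c ^+ n).
rewrite -mulmxA IHn mulmxA shift_vander -mulmxA; congr (_ *m _).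
by apply/matrixP=> i j; rewrite mul_diag_mx !mxE mulrnAr exprS.
Qed.

Lemma shiftX_diag n :
  shift_mx d c ^+ n =
  vander al *m diag_mx (\row_j al j ^+ n) *m invmx (vander al).
Proof. by rewrite -shiftX_vander mulmxK ?vander_unit. Qed.

Lemma det_shiftX n : \det (shift_mx d c ^+ n) = \prod_j al j ^+ n.
Proof.
rewrite shiftX_diag !det_mulmx mulrAC -det_mulmx mulmxV ?vander_unit //.
by rewrite det1 mul1r det_diag; apply: eq_bigr => j _; rewrite mxE.
Qed.

Lemma char_poly_shiftX n :
  char_poly (shift_mx d c ^+ n) = \prod_j ('X - (al j ^+ n)%:P).
Proof.
rewrite shiftX_diag; set V := vander al; set D := diag_mx _.
have VU : V \in unitmx by apply: vander_unit.
rewrite /char_poly /char_poly_mx.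
have -> : 'X%:M - map_mx polyC (V *m D *m invmx V) =
   map_mx polyC V *m ('X%:M - map_mx polyC D) *m map_mx polyC (invmx V).
  rewrite mulmxBr mulmxBl -!map_mxM; congr (_ - _).
  by rewrite scalar_mxC -mulmxA -map_mxM mulmxV // map_mx1 mulmx1.
rewrite !det_mulmx mulrAC -det_mulmx -map_mxM mulmxV // map_mx1 det1 mul1r.
have -> : 'X%:M - map_mx polyC D = diag_mx (\row_j ('X - (al j ^+ n)%:P)).
  apply/matrixP=> i j; rewrite !mxE.
  by case: eqP => _; rewrite ?mulr1n ?mulr0n ?subr0.
by rewrite det_diag; apply: eq_bigr => j _; rewrite mxE.
Qed.

(* The 0-th coordinate of A^n w is a combination of the geometric sequences
   al j ^+ n, so vanishing along r, r + L, ..., r + (d - 1) L is a Vandermonde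
   system with nodes al j ^+ L. *)
Lemma shift_orbit_eq0 (w : 'cV[F]_d) (r L : nat) :
    (forall j, al j != 0) -> injective (fun j => al j ^+ L) ->
  (forall m, (m < d)%N -> (shift_mx d c ^+ (r + L * m) *m w) 0 0 = 0) ->
  w = 0.
Proof.
move=> al0 alL_inj w0.
set V := vander al; pose b := invmx V *m w.
have VU : V \in unitmx by apply: vander_unit.
suff b0 : b = 0 by rewrite -[w](mulKVmx VU) -/b b0 mulmx0.
pose b' : 'rV[F]_d := \row_j (al j ^+ r * b j 0).
pose V' := \matrix_(m < d, j < d) (al j ^+ L) ^+ m : 'M[F]_d.
have V'U : V' \in unitmx.
  have -> : V' = Vandermonde d (\row_j al j ^+ L) by apply/matrixP=> i j; rewrite !mxE.
  rewrite unitmxE det_Vandermonde unitfE; apply/prodf_neq0 => i _.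
  apply/prodf_neq0 => j ltij; rewrite !mxE subr_eq0.
  by apply: contraTneq ltij => /alL_inj->; rewrite ltnn.
have : V' *m b'^T = 0.
  apply/matrixP=> m j; rewrite ord1 !mxE -[RHS](w0 m (ltn_ord m)).
  rewrite shiftX_diag -!mulmxA -/V -/b mxE; apply: eq_bigr => k _.
  rewrite !mul_diag_mx !mxE expr0 mul1r mulrA exprD exprM.
  by congr (_ * _); rewrite mulrC.
move/(congr1 (mulmx (invmx V'))); rewrite mulKmx // mulmx0 => b'0.
apply/matrixP=> j k; rewrite ord1 [RHS]mxE.
have /eqP := congr1 (fun M : 'cV[F]_d => M j 0) b'0; rewrite !mxE mulf_eq0.
by rewrite expf_eq0 (negbTE (al0 j)) andbF /= => /eqP.
Qed.

End Spectral.

(** * Zeros of congruent linear recurrences *)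

Lemma sum_nat_residues (F : nat -> nat) p q :
  (\sum_(m < p * q) F m = \sum_(a < p) \sum_(m < q) F (a + p * m))%N.
Proof.
elim: q => [|q IHq].
  by rewrite muln0 big_ord0 big1 // => a _; rewrite big_ord0.
under [RHS]eq_bigr do rewrite big_ord_recr /=.
rewrite big_split /= -IHq mulnS addnC big_split_ord /=; congr (_ + _)%N.
by apply: eq_bigr => a _; rewrite addnC.
Qed.

(** Descent along base p digits: only e of the p residue classes can contain a zero, and on each of
    them the restriction is again in [CC]. *)
Lemma count_zeros_iter (CC : (nat -> int) -> Prop) p e :
  (forall f a, CC f -> CC (fun m => f (a + p * m)%N)) ->
  (forall f, CC f -> (#|[set a : 'I_p | `[< exists m, f (a + p * m)%N = 0 >]]| <= e)%N) ->
  forall j f, CC f -> (\sum_(m < p ^ j) (f m == 0%R) <= e ^ j)%N.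
Proof.
move=> CCs CCe; elim=> [|j IHj] f Cf.
  by rewrite expn0 big_ord1; case: (_ == _).
rewrite !expnS (sum_nat_residues (fun m => (f m == 0) : nat)).
set A := [set a : 'I_p | `[< exists m, f (a + p * m)%N = 0 >]].
rewrite (bigID (fun a => a \in A)) /= [X in (_ + X)%N]big1 ?addn0; last first.
  move=> a; rewrite inE => /asboolPn na; apply: big1 => m _.
  by case: eqP => // fm; case: na; exists m.
apply: (@leq_trans (\sum_(a in A) e ^ j)%N).
  by apply: leq_sum => a _; apply: (IHj (fun m => f (a + p * m)%N)); apply: CCs.
by rewrite sum_nat_const leq_mul2r CCe ?orbT.
Qed.

Section ResidueZeros.
Variables (d' p : nat).
Let d := d'.+1.
Variables (E : 'M[int]_d) (rho : 'rV[int]_d) (w : 'cV[int]_d).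
Hypothesis p_pr : prime p.
Hypothesis le_dp : (d <= p)%N.
Hypothesis dvdE : forall i j, (p%:Z %| E i j)%Z.

Let c j := (rho *m E ^+ j *m w) 0 0.
Let f m := (rho *m (1 + E) ^+ m *m w) 0 0.

Lemma binomial_shift m : f m = \sum_(j < m.+1) c j * 'C(m, j)%:R.
Proof.
rewrite /f addrC exprDn_comm; last exact: commr1.
rewrite mulmx_sumr mulmx_suml summxE; under eq_bigr => j _ do rewrite expr1n mulr1.
rewrite (reindex_inj rev_ord_inj) /=; apply: eq_bigr => j _.
rewrite subSS subKn ?bin_sub; last by rewrite -ltnS.
by rewrite -scaler_nat -scalemxAr -scalemxAl [LHS]mxE mulrC.
all: by rewrite -ltnS.
Qed.

Let chi := char_poly E.

Lemma charpoly_coef_dvd j : (j < d)%N -> (p%:Z %| chi`_j)%Z.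
Proof.
move=> ltjd.
have E0 : map_mx (intr : int -> 'F_p) E = 0.
  apply/matrixP=> i k; rewrite !mxE; have /dvdzP[q ->] := dvdE i k.
  by rewrite intrM -[X in _ * X]/(p%:R) pchar_Fp_0 // mulr0.
have : (map_poly intr chi : {poly 'F_p})`_j = 0.
  rewrite /chi map_char_poly E0 /char_poly /char_poly_mx map_mx0 subr0 det_scalar.
  by rewrite coefXn ltn_eqF.
rewrite coef_map /= => /eqP.
by rewrite -(dvdz_pcharf (pchar_Fp p_pr)).
Qed.

(** Cayley-Hamilton: since E = 0 mod p, all lower coefficients of [chi] are divisible by p, and the
    recurrence they give gains a factor p from index d on. *)
Lemma coef_dvd_step v : (forall j, (j < d)%N -> (p%:Z ^+ v %| c j)%Z) ->
  forall j, (d <= j)%N -> (p%:Z ^+ v.+1 %| c j)%Z.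
Proof.
move=> dvc j; elim/ltn_ind: j => j IHj ledj.
have {IHj} IHj k : (k < j)%N -> (p%:Z ^+ v %| c k)%Z.
  move=> ltkj; have [/dvc//|ledk] := ltnP k d.
  by apply: dvdz_trans (IHj _ ltkj ledk); rewrite exprSr dvdz_mulr.
have szchi : size chi = d.+1 by rewrite size_char_poly.
have CH := Cayley_Hamilton E.
have Ed : E ^+ d = - \sum_(k < d) chi`_k *: E ^+ k.
  have chiE : horner_mx E chi = \sum_(k < size chi) chi`_k *: E ^+ k.
    rewrite -{1}[chi]coefK poly_def rmorph_sum /=; apply: eq_bigr => k _.
    by rewrite linearZ rmorphXn /= horner_mx_X.
  move: CH; rewrite -/chi chiE szchi.
  rewrite big_ord_recr /=.
  have -> : chi`_d = 1 by have /monicP := char_poly_monic E; rewrite lead_coefE -/chi szchi.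
  by rewrite scale1r => /eqP; rewrite addrC addr_eq0 => /eqP ->.
have -> : c j = - \sum_(k < d) chi`_k * c (k + (j - d))%N.
  rewrite /c -{1}(subnKC ledj) exprD Ed mulNr mulmxN mulNmx mxE; congr (- _).
  rewrite mulr_suml mulmx_sumr mulmx_suml summxE; apply: eq_bigr => k _.
  by rewrite exprD -scalerAl -scalemxAr -scalemxAl mxE.
rewrite rpredN; apply: rpred_sum => k _.
rewrite exprS; apply: dvdz_mul; first by exact: charpoly_coef_dvd.
by apply: IHj; have := ltn_ord k; lia.
Qed.

Hypothesis c_neq0 : exists2 j, (j < d)%N & c j != 0.

(** After division by the largest power of p common to c 0, ..., c (d - 1), the binomial expansion
    of f reduces mod p to a nonzero polynomial in m of degree below d, and a zero of f at a + p m
    makes a a root of it. As d <= p, the factorials in the denominators are invertible. *)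
Lemma card_zero_residues :
  (#|[set a : 'I_p | `[< exists m, f (a + p * m)%N = 0 >]]| <= d')%N.
Proof.
have p1 := prime_gt1 p_pr.
have [v [dvc [j0 ltj0 ndv]]] : exists v, (forall j, (j < d)%N -> (p%:Z ^+ v %| c j)%Z) /\
    exists2 j, (j < d)%N & ~~ (p%:Z ^+ v.+1 %| c j)%Z.
  pose P v := [forall j : 'I_d, (p%:Z ^+ v %| c j)%Z].
  have P0 : exists v, P v by exists 0%N; apply/forallP => j; rewrite expr0 dvd1z.
  case: c_neq0 => j1 ltj1 cj1.
  have Pb v : P v -> (v <= `|c j1|)%N.
    move/forallP/(_ (Ordinal ltj1)); rewrite dvdzE abszX /= => dvv.
    by apply: leq_trans (ltnW (ltn_expl v p1)) (dvdn_leq _ dvv); rewrite absz_gt0.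
  case: (ex_maxnP P0 Pb) => v Pv maxv; exists v; split.
    by move=> j ltj; apply: (forallP Pv (Ordinal ltj)).
  have : ~~ P v.+1 by apply/negP => /maxv; rewrite ltnn.
  by rewrite negb_forall => /existsP[j nd]; exists j.
have dvc' := coef_dvd_step dvc.
pose c' j : int := (c j %/ p%:Z ^+ v)%Z.
have pv0 : p%:Z ^+ v != 0 by rewrite expf_neq0 // -lt0n prime_gt0.
have cE j : c j = c' j * p%:Z ^+ v.
  rewrite /c' divzK //; have [/dvc//|/dvc'] := ltnP j d.
  by apply: dvdz_trans; rewrite exprSr dvdz_mulr.
have c'big j : (d <= j)%N -> (c' j)%:~R = 0 :> 'F_p.
  move/dvc'; rewrite cE exprS dvdz_mul2r // => /dvdzP[q ->].
  by rewrite intrM -[X in _ * X]/(p%:R) pchar_Fp_0 // mulr0.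
pose S m : 'F_p := \sum_(j < d) (c' j)%:~R * 'C(m, j)%:R.
have fS m : f m = 0 -> S m = 0.
  rewrite binomial_shift => fm.
  have : (\sum_(j < m.+1) c' j * 'C(m, j)%:R : int) = 0.
    apply: (mulIf pv0); rewrite mul0r -[RHS]fm mulr_suml; apply: eq_bigr => j _.
    by rewrite cE mulrAC.
  move/(congr1 (fun x : int => x%:~R : 'F_p)); rewrite rmorph_sum /= mulr0z => <-.
  pose G j : 'F_p := (c' j)%:~R * 'C(m, j)%:R.
  have Gout n (n0 : nat) : (forall j, (n0 <= j)%N -> G j = 0) -> (n0 <= n)%N ->
     \sum_(j < n) G j = \sum_(j < n0) G j.
    move=> G0 le; rewrite -(subnKC le) big_split_ord /= [X in _ + X]big1 ?addr0 //.
    by move=> j _; apply: G0; rewrite leq_addr.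
  transitivity (\sum_(j < d + m.+1) G j).
    by rewrite (Gout _ d) ?leq_addr // => j /c'big e; rewrite /G e mul0r.
  rewrite (Gout _ m.+1) ?leq_addl //; last by move=> j lt; rewrite /G bin_small ?mulr0.
  by apply: eq_bigr => j _; rewrite intrM natz.
(* The values S 0, ..., S (d - 1) determine the reduced coefficients triangularly, and these are not
   all zero. *)
have S_neq0 : exists m, S m != 0.
  apply: contrapT => /forallNP S0.
  suff c0 n : (n < d)%N -> (c' n)%:~R = 0 :> 'F_p.
    move/negP: ndv; apply; rewrite cE exprS dvdz_mul2r //.
    by rewrite (dvdz_pcharf (pchar_Fp p_pr)) c0.
  elim/ltn_ind: n => n IHn ltn; have /negP/negPn/eqP := S0 n.
  rewrite /S (bigD1 (Ordinal ltn)) //= binn mulr1 big1 ?addr0 // => j nj.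
  have [lt|le] := ltnP j n; first by rewrite IHn ?mul0r.
  rewrite bin_small ?mulr0 // ltn_neqAle le andbT.
  by apply: contraNneq nj => e; apply/eqP/val_inj.
pose P : {poly 'F_p} := \sum_(j < d) ((c' j)%:~R / (j`!)%:R) *: \prod_(i < j) ('X - (i%:R)%:P).
have PS m : P.[m%:R] = S m.
  rewrite horner_sum; apply: eq_bigr => j _; rewrite hornerZ -mulrA; congr (_ * _).
  have fu : (j`!)%:R != 0 :> 'F_p.
    rewrite -(dvdn_pcharf (pchar_Fp p_pr)) -prime_coprime // coprime_sym.
    have : (j < p)%N by apply: leq_trans (ltn_ord j) le_dp.
    elim: (val j) => [|k IHk] ltk; first by rewrite coprime1n.
    rewrite factS coprimeMl IHk 1?ltnW // andbT coprime_sym prime_coprime // gtnNdvd //.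
  apply: (mulfI fu); rewrite mulVKf // -natrM mulnC bin_ffact.
  elim: (val j) => [|k IHk]; first by rewrite big_ord0 hornerC ffactn0.
  rewrite big_ord_recr /= hornerM IHk ffactnSr hornerXsubC natrM.
  have [lekm|ltmk] := leqP k m; first by rewrite natrB.
  by rewrite ffact_small // !mul0r.
have P_neq0 : P != 0.
  by case: S_neq0 => m; rewrite -PS; apply: contraNneq => ->; rewrite horner0.
have szP : (size P <= d)%N.
  apply: leq_trans (size_sum _ _ _) _; apply/bigmax_leqP => j _.
  apply: leq_trans (size_scale_leq _ _) _.
  by rewrite size_prod_XsubC /index_enum -enumT size_enum_ord ltn_ord.
rewrite -ltnS; apply: leq_trans szP; set A := [set _ | _].
pose rs := [seq (val a)%:R : 'F_p | a <- enum A].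
have -> : #|A| = size rs by rewrite size_map -cardE.
apply: (max_poly_roots P_neq0).
  apply/allP => x /mapP[a]; rewrite mem_enum inE => /asboolP[m fm] ->.
  apply/rootP; have := fS _ fm; rewrite -PS natrD natrM pchar_Fp_0 // mul0r addr0.
  exact.
rewrite map_inj_in_uniq ?enum_uniq // => a b _ _.
move=> e; apply/val_inj; move: (congr1 (@nat_of_ord _) e).
by rewrite !val_Fp_nat // !modn_small ?ltn_ord.
Qed.

End ResidueZeros.

(** Injectivity of the L-th powers is simplicity of the roots for L = 1 and the absence of roots of
    unity among their ratios for larger L. *)
Definition nondegenerate_spectrum (C : numClosedFieldType) d (c : nat -> int) (al : 'I_d -> C) :=
  [/\ forall j, al j ^+ d = \sum_(i < d) (c i)%:~R * al j ^+ i,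
      forall j, al j != 0 &
      forall L, (0 < L)%N -> injective (fun j => al j ^+ L)].

Lemma mup_prod_XsubC (F : fieldType) (x : F) (r : seq F) :
  mup x (\prod_(z <- r) ('X - z%:P)) = count_mem x r.
Proof.
elim: r => [|z r IHr].
  by rewrite big_nil mupNroot // rootE hornerC oner_neq0.
rewrite big_cons mupM ?polyXsubC_eq0 //; last by rewrite -size_poly_eq0 size_prod_XsubC.
by rewrite IHr /= -['X - _]expr1 mup_XsubCX; case: eqP.
Qed.

Lemma spectrum_exists (C : numClosedFieldType) d (c : nat -> int) :
  (0 < d)%N -> simple_recurrence C d c -> nondegenerate_recurrence C d c ->
  exists al : 'I_d -> C, nondegenerate_spectrum c al.
Proof.
move=> d0 simp [c0 nondeg]; set f := complex_recurrence_poly C d c in simp nondeg *.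
have fE : f = 'X^d - \sum_(i < d) (c i)%:~R *: 'X^i.
  rewrite /f /complex_recurrence_poly /recurrence_poly rmorphB /= map_polyXn.
  congr (_ - _); rewrite rmorph_sum /=; apply: eq_bigr => i _.
  by rewrite map_polyZ /= map_polyXn.
have szS : (size (\sum_(i < d) (c i)%:~R *: 'X^i : {poly C})%R < d.+1)%N.
  rewrite ltnS; apply: leq_trans (size_sum _ _ _) _; apply/bigmax_leqP => j _.
  by apply: leq_trans (size_scale_leq _ _) _; rewrite size_polyXn.
have szf : size f = d.+1 by rewrite fE size_polyDl ?size_polyXn ?size_polyN.
have fmon : f \is monic.
  by rewrite fE monicE lead_coefDl ?size_polyXn ?size_polyN // lead_coefXn.
have [r fr] := closed_field_poly_normal f; rewrite (monicP fmon) scale1r in fr.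
have szr : size r = d by apply/eqP; rewrite -eqSS -szf fr size_prod_XsubC.
have Ur : uniq r.
  apply: count_mem_uniq => x.
  have := simp x; rewrite -/f fr mup_prod_XsubC => lex.
  by case: (boolP (x \in r)) => [xr|/count_memPn->//]; move: lex xr; rewrite -has_pred1 has_count; case: (count _ _) => [|[]].
have rootr x : root f x = (x \in r) by rewrite fr root_prod_XsubC.
pose al (j : 'I_d) := r`_j.
have al_in j : al j \in r by apply: mem_nth; rewrite szr.
have f0 j : f.[al j] = 0 by apply/rootP; rewrite rootr.
have fal x : f.[x] = x ^+ d - \sum_(i < d) (c i)%:~R * x ^+ i.
  rewrite fE hornerD hornerN hornerXn horner_sum; congr (_ - _).
  by apply: eq_bigr => i _; rewrite hornerZ hornerXn.
have al0 j : al j != 0.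
  apply/eqP => e; have := f0 j; rewrite fal e => /eqP; rewrite expr0n -leqn0 leqNgt d0.
  rewrite sub0r oppr_eq0 (bigD1 (Ordinal d0)) //= expr0 mulr1 big1 ?addr0 ?intr_eq0 ?(negbTE c0) //.
  by move=> i; rewrite -val_eqE /= => /negbTE i0; rewrite expr0n i0 mulr0.
exists al; split => //.
  by move=> j; apply/eqP; rewrite -subr_eq0 -fal f0.
move=> L L0 i j /= eL; apply/eqP; apply: contraT => nij.
have nal : al i != al j by rewrite nth_uniq ?szr.
have := nondeg _ _ _ _ nal _ L0; rewrite -/f !rootr !al_in => /(_ isT isT) /negP[].
by apply/unity_rootP; rewrite exprMn exprVn eL divff // expf_neq0.
Qed.

Section Orbit.
Variables (C : numClosedFieldType) (d' : nat).
Let d := d'.+1.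
Variables (c : nat -> int) (al : 'I_d -> C).
Hypothesis spec : nondegenerate_spectrum c al.
Let A := shift_mx d c.

Lemma spectrum_inj : injective al.
Proof. by case: spec => _ _ /(_ 1%N isT) inj i j e; apply: inj; rewrite e. Qed.

Lemma det_shift_neq0 : \det A != 0.
Proof.
case: spec => [rt a0 _]; rewrite -(intr_eq0 C) -det_map_mx map_shift_mx.
rewrite -[shift_mx _ _]expr1 (det_shiftX rt spectrum_inj).
by apply/prodf_neq0 => j _; rewrite expr1.
Qed.

Lemma orbit_neq0 (w : 'cV[int]_d) r L : w != 0 -> (0 < L)%N ->
  exists m, (A ^+ (r + L * m) *m w) 0 0 != 0.
Proof.
move=> w0 L0; apply: contrapT => /forallNP ze; case: spec => [rt a0 inj].
suff : map_mx intr w = 0 :> 'cV[C]_d.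
  move=> wC; case/eqP: w0; apply/matrixP => i k.
  have /eqP := congr1 (fun M : 'cV[C]_d => M i k) wC.
  by rewrite !mxE intr_eq0 => /eqP.
apply: (shift_orbit_eq0 rt spectrum_inj (r := r) (L := L)) => //; first exact: inj.
move=> m _; have /negP/negPn/eqP e := ze m.
transitivity ((map_mx intr (A ^+ (r + L * m) *m w) : 'cV[C]_d) 0 0); last by rewrite mxE e.
by rewrite map_mxM map_mxXn map_shift_mx.
Qed.

Lemma powers_eq1_mod (p : nat) (B : 'M[int]_d) : prime p -> ~~ (p%:Z %| \det B)%Z ->
  exists2 L, (0 < L)%N & map_mx intr (B ^+ L) = 1 :> 'M['F_p]_d.
Proof.
move=> p_pr; rewrite (dvdz_pcharf (pchar_Fp p_pr)) -det_map_mx => detB.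
set Bp := map_mx _ B in detB; have Bu : Bp \is a GRing.unit by move: detB; rewrite -unitfE -unitmxE.
pose g (i : 'I_(#|{: 'M['F_p]_d}|.+1)) := Bp ^+ i.
have : ~~ injectiveb g by apply/injectiveP => /leq_card; rewrite card_ord ltnn.
case/injectivePn => i [j nij eij].
wlog ltij : i j eij nij / (i < j)%N.
  move=> W; have := nij; case: (ltngtP i j) => [lt _|gt _|/val_inj->]; last by rewrite eqxx.
    exact: W eij nij lt.
  by apply: (W j i) => //; rewrite eq_sym.
exists (j - i)%N; first by rewrite subn_gt0.
rewrite map_mxXn -/Bp; apply: (mulrI (unitrX i Bu)).
by rewrite mulr1 -exprD subnKC ?(ltnW ltij) // -[RHS]eij.
Qed.

(** The class fed to [count_zeros_iter]. Nonvanishing is asked on every progression so that the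
    class survives passing from m to a + p m. *)
Definition congruent_orbit (p : nat) (f : nat -> int) :=
  (exists (rho : 'rV[int]_d) (B : 'M[int]_d) (w : 'cV[int]_d),
     map_mx intr B = 1 :> 'M['F_p]_d /\ forall m, f m = (rho *m B ^+ m *m w) 0 0) /\
  forall a q, (0 < q)%N -> exists j, f (a + q * j)%N != 0.

Lemma congruent_orbit_shift p f a : (0 < p)%N ->
  congruent_orbit p f -> congruent_orbit p (fun m => f (a + p * m)%N).
Proof.
move=> p0 [[rho [B [w [B1 fE]]]] fn0]; split.
  exists (rho *m B ^+ a), (B ^+ p), w; split; first by rewrite map_mxXn B1 expr1n.
  by move=> m; rewrite fE exprD exprM !mulmxA.
move=> a' q q0; have pq0 : (0 < p * q)%N by rewrite muln_gt0 p0.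
have [j nz] := fn0 (a + p * a')%N _ pq0.
by exists j; move: nz; rewrite mulnDr addnA mulnA.
Qed.

Lemma congruent_orbit_zeros p f : prime p -> (d <= p)%N -> congruent_orbit p f ->
  (#|[set a : 'I_p | `[< exists m, f (a + p * m)%N = 0 >]]| <= d')%N.
Proof.
move=> p_pr ledp [[rho [B [w [B1 fE]]]] fn0].
pose E := B - 1; have BE : B = 1 + E by rewrite /E addrC subrK.
have dvdE i j : (p%:Z %| E i j)%Z.
  rewrite (dvdz_pcharf (pchar_Fp p_pr)); apply/eqP.
  have -> : (E i j)%:~R = (map_mx intr B - 1 : 'M['F_p]_d) i j.
    by rewrite !mxE intrB; congr (_ - _); case: eqP.
  by rewrite B1 subrr mxE.
have -> : [set a : 'I_p | `[< exists m, f (a + p * m)%N = 0 >]] =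
  [set a : 'I_p | `[< exists m, (rho *m (1 + E) ^+ (a + p * m) *m w) 0 0 = 0 >]].
  apply/setP => a; rewrite !inE; apply: asbool_equiv_eq; split=> -[m e]; exists m.
    by rewrite -BE -fE.
  by rewrite fE BE.
(* If the first d coefficients vanished, every later one would be divisible by all powers of p,
   hence zero, and f would vanish identically. *)
apply: card_zero_residues => //; apply: contrapT => nc.
have c0 j : (j < d)%N -> (rho *m E ^+ j *m w) 0 0 = 0.
  by move=> ltj; apply/eqP; apply: contrapT => /negP ne; apply: nc; exists j.
have call j : (rho *m E ^+ j *m w) 0 0 = 0.
  have [/c0//|ledj] := ltnP j d; set x := (_ *m _) 0 0.
  have dvx v : (p%:Z ^+ v.+1 %| x)%Z.
    by apply: (coef_dvd_step p_pr ledp dvdE _ ledj) => k /c0 ->; rewrite dvdz0.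
  apply/eqP; rewrite -absz_eq0 eqn0Ngt; apply/negP => x0.
  have := dvx `|x|%N; rewrite dvdzE abszX /= => /(dvdn_leq x0); apply/negP.
  by rewrite -ltnNge (ltn_trans (ltnSn _)) // ltn_expl ?prime_gt1.
have [j /eqP[]] := fn0 0%N 1%N isT.
by rewrite fE BE binomial_shift big1 // => k _; rewrite call mul0r.
Qed.

(** K depends on t but not on w. With A^L = 1 mod p, each of the L progressions of step L has at
    most (d - 1)^j zeros among p^j terms, and p is taken above (d - 1)^t. *)
Lemma orbit_zeros_bound t : exists2 K, (0 < K)%N & forall H (w : 'cV[int]_d),
  (0 < H)%N -> w != 0 ->
  ((\sum_(n < H) ((A ^+ n *m w) 0%R 0%R == 0%R)) ^ t <= K * H)%N.
Proof.
have [p ltp p_pr] := prime_above (maxn d (maxn (d' ^ t) `|\det A|)).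
move: ltp; rewrite !gtn_max => /and3P[ltdp lttp ltDp].
have p1 := prime_gt1 p_pr.
have [|L L0 AL] := powers_eq1_mod (B := A) p_pr.
  rewrite dvdzE /=; apply/negP => /dvdn_leq; rewrite absz_gt0 det_shift_neq0 => /(_ isT).
  by rewrite leqNgt ltDp.
exists (L ^ t * p)%N; first by rewrite muln_gt0 expn_gt0 L0 prime_gt0.
move=> H w H0 w0; pose z n := (A ^+ n *m w) 0 0; pose j := up_log p H.
have leHj : (H <= p ^ j)%N by apply: up_logP.
have lejH : (p ^ j <= p * H)%N.
  have [H1|H1] := leqP H 1.
    by have -> : j = 0%N; [apply/eqP; rewrite up_log_eq0 H1 orbT | rewrite muln_gt0 prime_gt0].
  rewrite /j; have /andP[] := up_log_bounds p1 H1.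
  have : (0 < up_log p H)%N by rewrite up_log_gt0 p1.
  by case: (up_log p H) => // k _ /= ltk _; rewrite expnS leq_mul2l ltnW ?orbT.
have le1 : (\sum_(n < H) (z n == 0) <= L * d' ^ j)%N.
  have leHL : (H <= L * p ^ j)%N by apply: leq_trans leHj _; rewrite leq_pmull.
  apply: (@leq_trans (\sum_(n < L * p ^ j) (z n == 0%R))%N).
    by rewrite -(subnKC leHL) big_split_ord /= leq_addr.
  rewrite (sum_nat_residues (fun n => (z n == 0) : nat)).
  apply: (@leq_trans (\sum_(r < L) d' ^ j)%N); last by rewrite sum_nat_const card_ord.
  apply: leq_sum => r _.
  apply: (@count_zeros_iter (congruent_orbit p) p d' _ _ j (fun m => z (r + L * m)%N)).
  - by move=> f a; apply: congruent_orbit_shift; apply: prime_gt0.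
  - by move=> f; apply: congruent_orbit_zeros => //; apply: ltnW.
  split.
    exists (delta_mx 0 0 *m A ^+ r), (A ^+ L), w; split => // m.
    rewrite /z exprD exprM -!mulmxA -rowE [RHS]mxE //.
  move=> a q q0; have Lq0 : (0 < L * q)%N by rewrite muln_gt0 L0.
  have [m nz] := orbit_neq0 (r + L * a) w0 Lq0.
  by exists m; move: nz; rewrite mulnDr addnA mulnA.
have [->|t0] := posnP t; first by rewrite !expn0 mul1n muln_gt0 prime_gt0.
apply: (@leq_trans ((L * d' ^ j) ^ t)); first by rewrite leq_exp2r.
rewrite expnMn -expnM [(j * t)%N]mulnC expnM -mulnA leq_mul2l.
apply/orP; right; apply: leq_trans lejH.
have [->|j0] := posnP j; first by rewrite !expn0.
by rewrite leq_exp2r // ltnW.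
Qed.

End Orbit.

(** * Recovering powers of the companion matrix from observations *)

(** Row i is the linear form reading the term at time h i off the initial state, so the determinant
    is D(h). *)
Definition orbit_mx d' (c : nat -> int) (h : 'I_d'.+1 -> nat) : 'M[int]_d'.+1 :=
  \matrix_(i, j) (shift_mx d'.+1 c ^+ h i) 0 j.

Section Independence.
Variables (C : numClosedFieldType) (d' : nat).
Let d := d'.+1.
Variables (c : nat -> int) (al : 'I_d -> C).
Hypothesis spec : nondegenerate_spectrum c al.
Let A := shift_mx d c.

Lemma rat_vector_scale n (v : 'rV[rat]_n.+1) : v != 0 ->
  exists2 w : 'cV[int]_n.+1, w != 0 &
    exists2 a : int, a != 0 & forall j, v 0 j * a%:~R = (w j 0)%:~R.
Proof.
move=> v0; have [q [a a0 pE]] := rat_poly_scale (rVpoly v).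
have aR0 : (a%:~R : rat) != 0 by rewrite intr_eq0.
have vE j : v 0 j * a%:~R = (q`_j)%:~R.
  have := congr1 (fun p : {poly rat} => p`_j) pE.
  by rewrite coef_rVpoly_ord coefZ coef_map /= => ->; rewrite mulrC mulVKf.
exists (\col_j q`_j); last by exists a => // j; rewrite mxE vE.
apply: contra_neq v0 => w0; apply/rowP => j; rewrite mxE; apply: (mulIf aR0).
have := congr1 (fun M : 'cV[int]_n.+1 => M j 0) w0; rewrite !mxE mul0r vE => ->.
by [].
Qed.

(** If the reading forms at the times of s had rank below d, some nonzero integer vector would be
    read as 0 at all of them, against [orbit_zeros_bound]. *)
Lemma independent_times t : (0 < t)%N -> exists2 K, (0 < K)%N & forall H (s : seq nat),
  uniq s -> {in s, forall n, (n < H)%N} -> (K * H < size s ^ t)%N ->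
  exists2 h : 'I_d -> nat, forall i, h i \in s & \det (orbit_mx c h) != 0.
Proof.
move=> t0; have [K K0 zK] := orbit_zeros_bound spec t.
exists K => // H s Us sH ltK.
pose M : 'M[rat]_(size s, d) := \matrix_(i, j) ((A ^+ nth 0%N s i) 0 j)%:~R.
have [Mfull|Mnfull] := boolP (row_full M).
  pose f := fullrankfun Mfull; exists (fun i => nth 0%N s (f i)); first by move=> i; apply: mem_nth.
  have := fullrowsub_unit Mfull; rewrite unitmxE unitfE -/f.
  have -> : rowsub f M = map_mx intr (orbit_mx c (fun i => nth 0%N s (f i))).
    by apply/matrixP=> i j; rewrite !mxE.
  by rewrite det_map_mx intr_eq0.
have : kermx M^T != 0 by rewrite kermx_eq0 /row_free mxrank_tr.
case/rowV0Pn => v /sub_kermxP vM v0.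
have [w w0 [a a0 vw]] := rat_vector_scale v0.
have wz n : n \in s -> (A ^+ n *m w) 0 0 == 0.
  move=> ns; have lt : (index n s < size s)%N by rewrite index_mem.
  have := congr1 (fun N : 'rV[rat]_(size s) => N 0 (Ordinal lt)) vM.
  rewrite !mxE => e; rewrite -(intr_eq0 rat) rmorph_sum /=.
  have -> : \sum_i ((A ^+ n) 0 i * w i 0)%:~R =
     (\sum_j v 0 j * M^T j (Ordinal lt)) * a%:~R :> rat.
    rewrite mulr_suml; apply: eq_bigr => j _.
    by rewrite intrM -vw [M^T _ _]mxE [M _ _]mxE nth_index //; ring.
  by rewrite e mul0r.
have H0 : (0 < H)%N.
  case: s sH ltK {Us M Mnfull vM wz} => [|n s] sH; first by rewrite exp0n.
  by move=> _; apply: leq_ltn_trans (leq0n n) (sH n (mem_head _ _)).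
move: ltK; rewrite ltnNge; case/negP; apply: leq_trans (zK H w H0 w0).
rewrite leq_exp2r //.
pose P n := (A ^+ n *m w) 0 0 == 0.
apply: (@leq_trans (count P (iota 0 H))).
  rewrite -size_filter; apply: uniq_leq_size => // n ns.
  by rewrite mem_filter /P wz // mem_iota sH.
rewrite -sum1_count big_mkcond /= -{1}[H]subn0 big_mkord.
by apply: leq_sum => i _; rewrite /P; case: (_ == _).
Qed.

End Independence.

Section Hankel.
Variables (d' : nat).
Let d := d'.+1.
Variables (u : nat -> int) (c : nat -> int).
Hypothesis rec : satisfies_recurrence u d c.
Let A := shift_mx d c.

Definition state_vector n : 'cV[int]_d := \col_i u (n + i)%N.
Definition hankel_mx n : 'M[int]_d := \matrix_(i, j) u (n + i + j)%N.

Lemma shift_state n : (1 <= n)%N -> A *m state_vector n = state_vector n.+1.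
Proof.
move=> n0; apply/matrixP => i j; rewrite ord1 shift_mxE !mxE.
case: ltnP => [lt|le]; first by rewrite ?mxE inordK // addnS.
have -> : val i = d' by apply/eqP; rewrite eqn_leq le -ltnS ltn_ord.
by rewrite addSnnS rec //; apply: eq_bigr => k _; rewrite mxE.
Qed.

Lemma shiftX_state n k : (1 <= n)%N -> A ^+ k *m state_vector n = state_vector (n + k)%N.
Proof.
move=> n0; elim: k => [|k IHk]; first by rewrite mul1mx addn0.
by rewrite exprS -mulmxA IHk shift_state ?addnS // ltn_addr.
Qed.

Lemma shiftX_hankel n k : (1 <= n)%N -> A ^+ k *m hankel_mx n = hankel_mx (n + k).
Proof.
move=> n0; have colH m j : col j (hankel_mx m) = state_vector (m + j).
  by apply/matrixP => i l; rewrite !mxE addnAC.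
apply/matrixP => i j.
have -> : (A ^+ k *m hankel_mx n) i j = (A ^+ k *m col j (hankel_mx n)) i 0.
  by rewrite [RHS]mxE [LHS]mxE; apply: eq_bigr => l _; rewrite [col _ _ _ _]mxE.
rewrite colH shiftX_state; last by rewrite ltn_addr.
by rewrite !mxE addnAC [RHS]/= -!addnA; congr u; lia.
Qed.

Lemma orbit_state h x : (1 <= x)%N -> orbit_mx c h *m state_vector x = \col_i u (x + h i)%N.
Proof.
move=> x0; apply/matrixP => i j; rewrite ord1.
have := congr1 (fun M : 'cV[int]_d => M 0 0) (shiftX_state (h i) x0).
rewrite !mxE addn0 => <-; apply: eq_bigr => k _.
by rewrite !mxE.
Qed.

Definition orbit_const (h : 'I_d -> nat) : int := \det (orbit_mx c h) * \det (hankel_mx 1).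

(* Solving for the state vector from d of its observations and then for the
   matrix from a full Hankel block. *)
Lemma shiftX_observed h x : (1 <= x)%N ->
  orbit_const h *: A ^+ x.-1 =
  (\matrix_(i, j) (A ^+ j *m (\adj (orbit_mx c h) *m \col_k u (x + h k)%N)) i 0)
    *m \adj (hankel_mx 1).
Proof.
move=> x0; have -> : \matrix_(i, j) (A ^+ j *m (\adj (orbit_mx c h) *m \col_k u (x + h k)%N)) i 0
  = \det (orbit_mx c h) *: hankel_mx x.
  apply/matrixP => i j; rewrite mxE -orbit_state // [\adj _ *m _]mulmxA mul_adj_mx.
  by rewrite mul_scalar_mx -scalemxAr shiftX_state // !mxE addnAC.
have -> : hankel_mx x = A ^+ x.-1 *m hankel_mx 1.
  by rewrite shiftX_hankel // add1n prednK.
rewrite -scalemxAl -mulmxA mul_mx_adj.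
by rewrite mul_mx_scalar scalerA.
Qed.

Lemma dvd_shiftX_observed h x (r : int) : (1 <= x)%N ->
  (forall i, (r %| u (x + h i)%N)%Z) ->
  forall i j, (r %| orbit_const h * (A ^+ x.-1) i j)%Z.
Proof.
move=> x0 ru i j.
have -> : orbit_const h * (A ^+ x.-1) i j = (orbit_const h *: A ^+ x.-1) i j by rewrite mxE.
rewrite shiftX_observed // mxE; apply: rpred_sum => k _; apply: dvdz_mulr.
rewrite !mxE; apply: rpred_sum => l _; apply: dvdz_mull.
by rewrite !mxE; apply: rpred_sum => m _; apply: dvdz_mull; rewrite mxE.
Qed.

(** Expanding det (A^(x - 1)) through the adjugate uses the divisibility of only one factor, so
    [orbit_const] stays at the first power and det A cancels. *)
Lemma dvd_orbit_const h x (r : int) : (1 <= x)%N -> coprimez r (\det A) ->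
  (forall i, (r %| u (x + h i)%N)%Z) -> (r %| orbit_const h)%Z.
Proof.
move=> x0 co ru; have dv := dvd_shiftX_observed x0 ru.
have : (r %| orbit_const h * \det (A ^+ x.-1))%Z.
  have -> : orbit_const h * \det (A ^+ x.-1) = ((orbit_const h *: A ^+ x.-1) *m \adj (A ^+ x.-1)) 0 0.
    by rewrite -scalemxAl mul_mx_adj !mxE mulr1n.
  by rewrite mxE; apply: rpred_sum => k _; apply: dvdz_mulr; rewrite mxE.
have -> : \det (A ^+ x.-1) = \det A ^+ x.-1.
  elim: (x.-1) => [|k IHk]; first by rewrite !expr0 det1.
  by rewrite !exprS -IHk -det_mulmx.
by rewrite Gauss_dvdzl // coprimezXr.
Qed.

End Hankel.

(** * Hankel determinants and sizes *)

Section MinimalOrder.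
Variable u : nat -> int.

Definition poly_act (q : {poly int}) n : int := \sum_(i < size q) q`_i * u (n + i)%N.
Definition annihilates (q : {poly int}) := forall n, (1 <= n)%N -> poly_act q n = 0.

Lemma poly_act_wide (q : {poly int}) N n : (size q <= N)%N ->
  poly_act q n = \sum_(i < N) q`_i * u (n + i)%N.
Proof.
move=> leN; rewrite -(subnKC leN) big_split_ord /= [X in _ = _ + X]big1 ?addr0 //.
by move=> i _; rewrite nth_default ?mul0r // leq_addr.
Qed.

Lemma poly_actD p q n : poly_act (p + q) n = poly_act p n + poly_act q n.
Proof.
have lp := leq_maxl (size p) (size q); have lq := leq_maxr (size p) (size q).
rewrite (poly_act_wide _ (size_polyD p q)) (poly_act_wide n lp) (poly_act_wide n lq).
by rewrite -big_split; apply: eq_bigr => i _; rewrite coefD mulrDl.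
Qed.

Lemma poly_actZ a p n : poly_act (a *: p) n = a * poly_act p n.
Proof.
rewrite (poly_act_wide _ (size_scale_leq a p)) mulr_sumr.
by apply: eq_bigr => i _; rewrite coefZ mulrA.
Qed.

Lemma poly_actMX p n : poly_act (p * 'X) n = poly_act p n.+1.
Proof.
have le : (size (p * 'X)%R <= (size p).+1)%N.
  by apply: leq_trans (size_polyMleq _ _) _; rewrite size_polyX addn2.
rewrite (poly_act_wide _ le) big_ord_recl coefMX mul0r add0r.
by apply: eq_bigr => i _; rewrite coefMX /= addSnnS.
Qed.

Lemma annihilatesM r p : annihilates p -> annihilates (r * p).
Proof.
move=> ap; elim/poly_ind: r => [|r a IHr] n n0.
  by rewrite mul0r /poly_act size_poly0 big_ord0.
rewrite mulrDl poly_actD -mulrA -commr_polyX mulrA poly_actMX IHr // add0r.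
by rewrite mul_polyC poly_actZ ap ?mulr0.
Qed.

Lemma annihilates_primitive p : annihilates p -> annihilates (zprimitive p).
Proof.
have [-> _|p0] := eqVneq p 0; first by rewrite zprimitive0 => n _; rewrite /poly_act size_poly0 big_ord0.
move=> ap n n0; apply: (mulfI (x := zcontents p)); first by rewrite zcontents_eq0.
by rewrite -poly_actZ -zpolyEprim ap ?mulr0.
Qed.

Lemma recurrence_poly_monic d (c : nat -> int) :
  recurrence_poly d c \is monic /\ size (recurrence_poly d c) = d.+1.
Proof.
have szS : (size (- \sum_(i < d) c i *: 'X^i : {poly int})%R < size ('X^d : {poly int})%R)%N.
  rewrite size_polyN size_polyXn ltnS.
  apply: leq_trans (size_sum _ _ _) _; apply/bigmax_leqP => j _.
  by apply: leq_trans (size_scale_leq _ _) _; rewrite size_polyXn.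
by rewrite monicE /recurrence_poly lead_coefDl // lead_coefXn size_polyDl // size_polyXn.
Qed.

Lemma coef_recurrence_poly d (c : nat -> int) (i : 'I_d) :
  (recurrence_poly d c)`_i = - c i.
Proof.
rewrite /recurrence_poly coefB coefXn ltn_eqF // sub0r coef_sum (bigD1 i) //=.
rewrite coefZ coefXn eqxx mulr1 big1 ?addr0 // => j nj.
by rewrite coefZ coefXn eq_sym (negbTE (_ : j != i :> nat)) ?mulr0.
Qed.

Lemma annihilates_recurrence d (c : nat -> int) :
  satisfies_recurrence u d c -> annihilates (recurrence_poly d c).
Proof.
move=> rec n n0; have [mon sz] := recurrence_poly_monic d c.
rewrite /poly_act sz big_ord_recr /=.
have -> : (recurrence_poly d c)`_d = 1 by have := monicP mon; rewrite lead_coefE sz.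
rewrite mul1r rec // -big_split /=; apply: big1 => i _.
by rewrite coef_recurrence_poly mulNr addNr.
Qed.

(* Gauss's lemma makes the annihilator of least degree monic up to sign, so a
   recurrence of minimal order over the integers is minimal over the rationals. *)
Lemma annihilator_size d (c : nat -> int) q : linear_recurrence u d c -> (2 <= d)%N ->
  q != 0 -> annihilates q -> (d < size q)%N.
Proof.
move=> [d1 rec mini] d2 q0 aq; rewrite ltnNge; apply/negP => szq.
pose P n := `[< exists g, [/\ g != 0, annihilates g & size g = n] >].
have exP : exists n, P n by exists (size q); apply/asboolP; exists q.
case: (ex_minnP exP) => n /asboolP[g [g0 ag <-]] ming.
have szg : (size g <= d)%N by apply: leq_trans szq; apply: ming; apply/asboolP; exists q.
have [fmon szf] := recurrence_poly_monic d c; set f := recurrence_poly d c in fmon szf.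
have af : annihilates f := annihilates_recurrence rec.
have gf : g %| f.
  rewrite /dvdp; apply: contraT => r0; have := ltn_modpN0 f g0.
  rewrite ltnNge ming //; apply/asboolP; exists (f %% g); split => // m m0.
  have /(congr1 (fun p => poly_act p m)) := Pdiv.Idomain.divp_eq f g.
  by rewrite poly_actZ af // poly_actD annihilatesM // mulr0 add0r => <-.
have [r fr] := dvdpP_int gf; set g1 := zprimitive g in fr.
have ag1 : annihilates g1 by apply: annihilates_primitive.
have szg1 : size g1 = size g by rewrite size_zprimitive.
have lg1 : lead_coef g1 ^+ 2 = 1.
  have : lead_coef g1 * lead_coef r = 1 by rewrite -lead_coefM -fr (monicP fmon).
  move/(congr1 absz); rewrite abszM => /eqP; rewrite muln_eq1 => /andP[/eqP e _].
  by have [->|->] : lead_coef g1 = 1 \/ lead_coef g1 = -1 by lia.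
have szg0 : (0 < size g)%N by rewrite size_poly_gt0.
pose e := (size g).-1.
have recg m : (1 <= m)%N -> u (m + e)%N = \sum_(i < e) (- lead_coef g1 * g1`_i) * u (m + i)%N.
  move=> m0; have := ag1 m m0; rewrite /poly_act szg1 -(prednK szg0) big_ord_recr /= -/e.
  have -> : g1`_e = lead_coef g1 by rewrite lead_coefE szg1.
  move=> E; have {E} : \sum_(i < e) g1`_i * u (m + i)%N = - (lead_coef g1 * u (m + e)%N).
    by apply/eqP; rewrite -addr_eq0 E.
  move/(congr1 (fun x => - lead_coef g1 * x)); rewrite mulrNN mulrA -expr2 lg1 mul1r => <-.
  by rewrite mulr_sumr; apply: eq_bigr => i _; rewrite mulrA.
(* A constant annihilator means that u vanishes from index 1 on; it then satisfies a recurrence of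
   order 1, which is shorter because d >= 2. *)
have [e0|e0] := posnP e.
  apply: (mini 1%N (fun=> 0)); first by rewrite d2.
  by move=> m m0; rewrite big_ord1 mul0r -[(m + 1)%N]addn0 -{2}e0 recg ?e0 ?big_ord0 // addn1.
apply: (mini e (fun i => - lead_coef g1 * g1`_i)); first by rewrite e0 /e prednK.
exact: recg.
Qed.

(** A left kernel vector is a polynomial of size at most d whose action on u vanishes at 1, ..., d.
    That action obeys the recurrence of u, so it vanishes everywhere, against [annihilator_size]. *)
Lemma det_hankel_neq0 d' (c : nat -> int) : linear_recurrence u d'.+1 c -> (0 < d')%N ->
  \det (hankel_mx d' u 1) != 0.
Proof.
move=> lin d'0; apply/det0P => -[v v0 vH]; have [_ rec _] := lin.
have q0 : rVpoly v != 0.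
  by apply: contra_neq v0 => e; rewrite -(rVpolyK v) e linear0.
have := annihilator_size lin d'0 q0; rewrite ltnNge size_poly => /(_ _)/negP; apply=> //.
suff w0 n : poly_act (rVpoly v) n.+1 = 0 by case.
have wE m : poly_act (rVpoly v) m = \sum_(i < d'.+1) v 0 i * u (m + i)%N.
  by rewrite (poly_act_wide _ (size_poly _ _)); apply: eq_bigr => i _; rewrite coef_rVpoly_ord.
elim/ltn_ind: n => n IHn; rewrite wE; have [ltn|le] := ltnP n d'.+1.
  have := congr1 (fun M : 'rV[int]_d'.+1 => M 0 (Ordinal ltn)) vH; rewrite !mxE => E.
  by rewrite -[RHS]E; apply: eq_bigr => i _; rewrite !mxE /=; congr (_ * u _); lia.
have -> : n.+1 = ((n - d').+1 + d')%N by lia.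
transitivity (\sum_(k < d'.+1) c k * poly_act (rVpoly v) (n - d' + k)%N).
  under [RHS]eq_bigr => k _ do rewrite wE mulr_sumr.
  rewrite exchange_big; apply: eq_bigr => i _ /=.
  have -> : ((n - d').+1 + d' + i = n - d' + i + d'.+1)%N by lia.
  rewrite rec; last by lia.
  rewrite mulr_sumr; apply: eq_bigr => k _; rewrite mulrCA; congr (_ * (_ * u _)); lia.
apply: big1 => k _; have /prednK <- : (0 < n - d' + k)%N by lia.
by rewrite IHn ?mulr0 //; have := ltn_ord k; lia.
Qed.

End MinimalOrder.

(** * Sizes of integer matrices and of terms *)

Lemma absz_sum_le (I : Type) (r : seq I) (P : pred I) (F : I -> int) :
  (`|(\sum_(i <- r | P i) F i)%R|%N <= \sum_(i <- r | P i) `|F i|%N)%N.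
Proof.
elim/big_ind2: _ => // [x1 x2 y1 y2 le1 le2]; apply: leq_trans (leq_add le1 le2).
lia.
Qed.

Lemma absz_prod (I : Type) (r : seq I) (P : pred I) (F : I -> int) :
  (`|(\prod_(i <- r | P i) F i)%R|%N = \prod_(i <- r | P i) `|F i|%N)%N.
Proof. by rewrite (big_morph absz abszM (erefl : `|1|%N = 1%N)). Qed.

Definition mx_size m n (X : 'M[int]_(m, n)) : nat := (\sum_i \sum_j `|X i j|)%N.

Lemma absz_le_mx_size m n (X : 'M[int]_(m, n)) i j : (`|X i j| <= mx_size X)%N.
Proof.
by rewrite /mx_size (bigD1 i) //= (bigD1 j) //= -addnA leq_addr.
Qed.

Lemma mx_sizeM m n p (X : 'M[int]_(m, n)) (Y : 'M[int]_(n, p)) :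
  (mx_size (X *m Y) <= mx_size X * mx_size Y)%N.
Proof.
apply: (@leq_trans (\sum_i \sum_j \sum_k `|X i k| * `|Y k j|)%N).
  apply: leq_sum => i _; apply: leq_sum => j _; rewrite mxE.
  apply: leq_trans (absz_sum_le _ _ _) _.
  by apply/eq_leq/eq_bigr => k _; rewrite abszM.
rewrite /mx_size big_distrl /=; apply: leq_sum => i _.
rewrite exchange_big big_distrl /=; apply: leq_sum => k _.
rewrite -big_distrr /= leq_mul2l; apply/orP; right.
by rewrite [leqRHS](bigD1 k) //= leq_addr.
Qed.

Lemma mx_sizeX d (X : 'M[int]_d) B n : (mx_size X <= B)%N -> (mx_size (1 : 'M[int]_d) <= B)%N ->
  (mx_size (X ^+ n) <= B ^ n.+1)%N.
Proof.
move=> XB oneB; elim: n => [|n IHn]; first by rewrite expr0 expn1.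
rewrite exprS expnS; apply: leq_trans (mx_sizeM _ _) _.
exact: leq_mul.
Qed.

Lemma absz_det_le d (X : 'M[int]_d) b : (forall i j, (`|X i j| <= b)%N) ->
  (`|\det X| <= d`! * b ^ d)%N.
Proof.
move=> Xb; apply: leq_trans (absz_sum_le _ _ _) _.
apply: (@leq_trans (\sum_(s : {perm 'I_d}) b ^ d)%N); last first.
  by rewrite sum_nat_const card_Sn.
apply: leq_sum => s _; rewrite abszM abszX exp1n mul1n absz_prod.
apply: leq_trans (leq_prod (E2 := fun=> b) _) _; first by move=> i _.
by rewrite prod_nat_const card_ord.
Qed.

Lemma absz_adj_le d' (X : 'M[int]_d'.+1) b : (0 < b)%N -> (forall i j, (`|X i j| <= b)%N) ->
  forall i j, (`|(\adj X) i j| <= d'.+1`! * b ^ d'.+1)%N.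
Proof.
move=> b0 Xb i j; rewrite mxE /cofactor abszM abszX exp1n mul1n.
apply: leq_trans (absz_det_le (b := b) _) _; first by move=> k l; rewrite !mxE.
rewrite factS expnS; have := fact_gt0 d'; move: b0 => /=.
set x := d'`!; set y := (b ^ d')%N => b0 x0.
by apply: leq_mul; rewrite ?leq_pmull.
Qed.

Lemma mx_size_le m n (X : 'M[int]_(m, n)) b : (forall i j, (`|X i j| <= b)%N) ->
  (mx_size X <= m * n * b)%N.
Proof.
move=> Xb; rewrite /mx_size; apply: (@leq_trans (\sum_(i < m) \sum_(j < n) b)%N).
  by apply: leq_sum => i _; apply: leq_sum => j _.
by rewrite sum_nat_const sum_nat_const !card_ord mulnA.
Qed.

Lemma leq_mul_expS k b n : (0 < k)%N -> (k * b ^ n.+1 <= (k * b) ^ n.+1)%N.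
Proof.
by move=> k0; rewrite expnMn leq_mul // expnS -[leqLHS]muln1 leq_mul // expn_gt0 k0.
Qed.

Section SizeBounds.
Variables (d' : nat).
Let d := d'.+1.
Variables (u : nat -> int) (c : nat -> int).
Hypothesis rec : satisfies_recurrence u d c.
Let A := shift_mx d c.

Lemma size_bounds : exists K, [/\ (1 < K)%N,
  forall m, (mx_size (A ^+ m) <= K ^ m.+1)%N,
  forall n, (1 <= n)%N -> (`|u n| <= K ^ n.+1)%N,
  forall (h : 'I_d -> nat) Y, (forall i, h i <= Y)%N -> (`|orbit_const u c h| <= K ^ Y.+1)%N &
  forall (h : 'I_d -> nat) x Y X, (1 <= x)%N -> (forall i, h i <= Y)%N ->
    (forall i, `|u (x + h i)| <= X)%N ->
    forall i j, (`|(orbit_const u c h * (A ^+ x.-1) i j)%R| <= K ^ Y.+1 * X)%N].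
Proof.
pose B := (mx_size A + mx_size (1 : 'M[int]_d)).+1.
have BA : (mx_size A <= B)%N by rewrite /B; lia.
have B1 : (mx_size (1 : 'M[int]_d) <= B)%N by rewrite /B; lia.
have powB m : (mx_size (A ^+ m) <= B ^ m.+1)%N by apply: mx_sizeX.
pose g := `|\det (hankel_mx d' u 1)|%N; pose G := mx_size (\adj (hankel_mx d' u 1)).
pose U1 := mx_size (state_vector d' u 1).
(* [P1] collects the constants of the last estimate: d * d for the outer matrix, B^d for the powers
   A^j, d * d * d! for the adjugate, d for the observations. [Q1] absorbs the initial state and the
   initial Hankel block. *)
pose P1 := (d * d * d * d * d * d`! * B ^ d)%N.
pose Q1 := (2 * g.+1 * G.+1 * U1.+1)%N.
have P1pos : (0 < P1)%N by rewrite !muln_gt0 fact_gt0 expn_gt0.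
have Q1gt1 : (1 < Q1)%N by rewrite /Q1; nia.
have Q1pos : (0 < Q1)%N by apply: ltnW.
pose K := (P1 * Q1 * B ^ d)%N.
have Bd : (0 < B ^ d)%N by rewrite expn_gt0.
have leBK : (B <= K)%N.
  rewrite /K; apply: (@leq_trans (B ^ d)); last by rewrite leq_pmull // muln_gt0 P1pos.
  by rewrite -{1}[B]expn1 leq_pexp2l.
have KY Y r : (r <= P1 * Q1 * (B ^ d) ^ Y.+1)%N -> (r <= K ^ Y.+1)%N.
  by move/leq_trans; apply; apply: leq_mul_expS; rewrite muln_gt0 P1pos.
have entry (h : 'I_d -> nat) Y : (forall i, h i <= Y)%N -> forall i j, (`|orbit_mx c h i j| <= B ^ Y.+1)%N.
  move=> hY i j; rewrite mxE; apply: leq_trans (absz_le_mx_size _ _ _) _.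
  by apply: leq_trans (powB (h i)) _; rewrite leq_pexp2l // ltnS.
exists K; split.
- by apply: leq_trans Q1gt1 _; rewrite /K -mulnA mulnCA leq_pmulr // muln_gt0 P1pos.
- move=> m; apply: leq_trans (powB m) _; rewrite leq_exp2r //.
- move=> n n0; have := congr1 (fun M : 'cV[int]_d => M 0 0) (shiftX_state rec n.-1 (leqnn 1)).
  rewrite [RHS]mxE addn0 add1n prednK // => <-.
  apply: leq_trans (absz_le_mx_size _ _ _) _; apply: leq_trans (mx_sizeM _ _) _.
  rewrite -/U1; apply: (@leq_trans (K ^ n * K)); last by rewrite expnSr.
  apply: leq_mul.
    by apply: leq_trans (powB _) _; rewrite prednK // leq_exp2r.
  by rewrite /K /Q1; nia.
- move=> h Y hY; apply: KY; rewrite /orbit_const abszM -/g.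
  have := absz_det_le (entry h Y hY); rewrite -expnM [(Y.+1 * _)%N]mulnC expnM.
  set e := (\det _); set z := ((B ^ d) ^ Y.+1)%N => le.
  apply: (@leq_trans (d`! * z * g)); first by rewrite leq_mul2r le orbT.
  rewrite mulnAC leq_mul2r; apply/orP; right.
  apply: leq_mul; last by rewrite /Q1; nia.
  by rewrite /P1 mulnAC leq_pmull // !muln_gt0 Bd.
- move=> h x Y X x0 hY uX i j.
  have -> : orbit_const u c h * (A ^+ x.-1) i j = (orbit_const u c h *: A ^+ x.-1) i j by rewrite mxE.
  rewrite (shiftX_observed rec) //; apply: leq_trans (absz_le_mx_size _ _ _) _.
  apply: leq_trans (mx_sizeM _ _) _; rewrite -/G.
  set Z := ((B ^ d) ^ Y.+1)%N.
  have le : (mx_size (\matrix_(i, j) (A ^+ j *m (\adj (orbit_mx c h) *m \col_k u (x + h k)%N)) i 0 : 'M_d)%R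
     <= d * d * (B ^ d * (d * d * (d`! * Z) * (d * X))))%N.
    apply: mx_size_le => k l; rewrite mxE; apply: leq_trans (absz_le_mx_size _ _ _) _.
    apply: leq_trans (mx_sizeM _ _) _; apply: leq_mul.
      by apply: leq_trans (powB _) _; rewrite leq_pexp2l.
    apply: leq_trans (mx_sizeM _ _) _; apply: leq_mul.
      apply: mx_size_le => a b; rewrite /Z -expnM [(d * _)%N]mulnC expnM.
      by apply: absz_adj_le; [rewrite expn_gt0 | apply: entry].
    rewrite -[X in (_ <= X * _)%N]muln1; apply: mx_size_le => a b; rewrite mxE; exact: uX.
  apply: leq_trans (leq_mul le (leqnn G)) _.
  have -> : (d * d * (B ^ d * (d * d * (d`! * Z) * (d * X))) * G = P1 * G * Z * X)%N.
    by rewrite /P1; ring.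
  rewrite leq_mul2r; apply/orP; right; apply: KY; rewrite -/Z leq_mul2r; apply/orP; right.
  by rewrite leq_mul2l; apply/orP; right; rewrite /Q1; nia.
Qed.

End SizeBounds.

(** * Height growth of the powers *)

Definition mx_content m n (X : 'M[int]_(m, n)) : nat :=
  (\big[gcdn/0]_(k : 'I_m * 'I_n) `|X k.1 k.2|)%N.

Lemma dvdn_content m n (X : 'M[int]_(m, n)) (r : nat) :
  reflect (forall i j, (r%:Z %| X i j)%Z) (r %| mx_content X)%N.
Proof.
apply: (iffP (dvdn_biggcdP _ _ _)) => [rX i j|rX [i j] _]; last exact: rX.
exact: (rX (i, j)).
Qed.

Lemma content_dvd m n (X : 'M[int]_(m, n)) i j : ((mx_content X)%:Z %| X i j)%Z.
Proof. by move: i j; apply/dvdn_content. Qed.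

Lemma content_mulmx m n p (X : 'M[int]_(m, n)) (Y : 'M[int]_(n, p)) :
  (mx_content X * mx_content Y %| mx_content (X *m Y))%N.
Proof.
apply/dvdn_content => i j; rewrite mxE; apply: rpred_sum => k _.
by rewrite PoszM; apply: dvdz_mul; apply: content_dvd.
Qed.

Lemma content_factor m n (X : 'M[int]_(m, n)) :
  exists Y : 'M[int]_(m, n), X = (mx_content X)%:Z *: Y.
Proof.
exists (\matrix_(i, j) (X i j %/ (mx_content X)%:Z)%Z); apply/matrixP => i j.
by rewrite !mxE mulrC divzK // content_dvd.
Qed.

Lemma content_det d (X : 'M[int]_d) : (mx_content X ^ d %| `|\det X|)%N.
Proof.
have [Y XY] := content_factor X.
by rewrite {2}XY detZ abszM abszX dvdn_mulr.
Qed.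

Lemma coef_comp_scale (R : comNzRingType) (p : {poly R}) (a : R) i :
  (p \Po (a *: 'X))`_i = a ^+ i * p`_i.
Proof.
rewrite comp_polyE coef_sum; have [lt|le] := ltnP i (size p); last first.
  rewrite [p`_i]nth_default // mulr0 big1 // => j _.
  by rewrite exprZn !coefZ coefXn gtn_eqF ?mulr0 //; apply: leq_trans (ltn_ord j) le.
rewrite (bigD1 (Ordinal lt)) //= exprZn !coefZ coefXn eqxx mulr1 mulrC big1 ?addr0 // => j nj.
by rewrite exprZn !coefZ coefXn eq_sym (negbTE (_ : j != i :> nat)) ?mulr0.
Qed.

Lemma char_polyZ (R : comNzRingType) d (X : 'M[R]_d) (r : R) :
  char_poly (r *: X) \Po (r *: 'X) = r ^+ d *: char_poly X.
Proof.
rewrite /char_poly -[_ \Po _]/(comp_poly (r *: 'X) _) -det_map_mx -[RHS]mul_polyC polyC_exp -detZ.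
congr (\det _); apply/matrixP => i j.
rewrite !mxE rmorphB /= comp_polyC mulrBr rmorphMn /= comp_polyX.
by rewrite mulrnAr mul_polyC -polyCM.
Qed.

(** By Bernoulli, (y + 1)^t outgrows K * y^t. This removes a bounded factor picked up on passing to
    large powers. *)
Lemma leq_of_powers (x y K : nat) :
  (forall T, exists2 t, (T <= t)%N & (x ^ t <= K * y ^ t)%N) -> (x <= y)%N.
Proof.
move=> pow; rewrite leqNgt; apply/negP => ltyx.
have [|y0] := posnP y.
  move=> y0; have [t t0] := pow 1%N; rewrite y0 exp0n // muln0 leqn0 expn_eq0 => /andP[/eqP x0].
  by move: ltyx; rewrite x0.
have bern t : ((y + t) * y ^ t <= y * y.+1 ^ t)%N.
  elim: t => [|t IHt]; first by rewrite addn0.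
  by rewrite !expnS; nia.
have [t let_ lex] := pow (y * K).+1.
have yt0 : (0 < y ^ t)%N by rewrite expn_gt0 y0.
have le1 : (y.+1 ^ t <= x ^ t)%N by case: t {let_ lex yt0} => // t; rewrite leq_exp2r.
have := bern t; nia.
Qed.

Lemma absz_shift_inj (K : nat) (a b : int) : (`|a| <= K)%N -> (`|b| <= K)%N ->
  (`|(a + K%:Z)%R| < (K + K).+1)%N /\ (`|(a + K%:Z)%R|%N = `|(b + K%:Z)%R|%N -> a = b).
Proof. by move=> aK bK; split; lia. Qed.

Section Height.
Variables (C : numClosedFieldType) (d' : nat).
Let d := d'.+1.
Variables (c : nat -> int) (al : 'I_d -> C).
Hypothesis archi : forall x : C, exists n : nat, `|x| <= n%:R.
Hypothesis spec : nondegenerate_spectrum c al.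
Hypothesis d'_gt0 : (0 < d')%N.
Let A := shift_mx d c.
Let delta := \det A.

Let rt : forall j, al j ^+ d = \sum_(i < d) (c i)%:~R * al j ^+ i.
Proof. by case: spec. Qed.
Let al0 : forall j, al j != 0.
Proof. by case: spec. Qed.
Let al_inj : injective al := spectrum_inj spec.

Lemma bounded_family (I : finType) (f : I -> C) : exists n : nat, forall i, `|f i| <= n%:R.
Proof.
have [g fg] := choice (fun i => archi (f i)); exists (\max_i g i)%N => i.
by apply: le_trans (fg i) _; rewrite ler_nat leq_bigmax.
Qed.

Lemma det_exp n : \det (A ^+ n) = delta ^+ n.
Proof.
elim: n => [|n IHn]; first by rewrite !expr0 det1.
by rewrite !exprS -IHn -det_mulmx.
Qed.

Lemma map_shiftX n : map_mx intr (A ^+ n) = shift_mx d (intr \o c) ^+ n :> 'M[C]_d.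
Proof. by rewrite map_mxXn map_shift_mx. Qed.

Lemma spectral_radius_bound : exists K : nat, forall n i,
  `|al i ^+ n| <= K%:R * (mx_size (A ^+ n))%:R.
Proof.
set V := vander al; have VU : V \in unitmx := vander_unit al_inj.
have [K1 VK] := bounded_family (fun k : 'I_d * 'I_d => invmx V k.1 k.2).
have [K2 VK'] := bounded_family (fun k : 'I_d * 'I_d => V k.1 k.2).
exists (K1 * K2)%N => n i.
have -> : al i ^+ n = (invmx V *m (shift_mx d (intr \o c) ^+ n *m V)) i i.
  by rewrite (shiftX_vander rt) mulKmx // !mxE eqxx mulr1n.
rewrite -map_shiftX mxE; apply: le_trans (ler_norm_sum _ _ _) _.
rewrite /mx_size natr_sum mulr_sumr; apply: ler_sum => k _.
rewrite mxE mulr_sumr natr_sum mulr_sumr; apply: le_trans (ler_norm_sum _ _ _) _.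
apply: ler_sum => l _; rewrite !mxE !normrM.
have -> : `|((A ^+ n) k l)%:~R| = `|((A ^+ n) k l)|%N%:R :> C by rewrite -intr_norm -abszE.
rewrite mulrCA [leRHS]mulrC ler_wpM2l ?ler0n // natrM; apply: ler_pM => //.
  exact: VK (i, k).
by have := VK' (l, i); rewrite mxE.
Qed.

(** Eigenvalues of A^d normalised to have product 1. The content of A^(d m) is at most |delta|^m, so
    |beta i|^m bounds size over content from below, up to a constant. *)
Let beta i := al i ^+ d / delta%:~R.

Lemma delta_neq0 : delta != 0.
Proof. exact: (det_shift_neq0 spec). Qed.

Let deltaC : delta%:~R != 0 :> C.
Proof. by rewrite intr_eq0 delta_neq0. Qed.

Lemma norm_intr_absz (x : int) : `|x%:~R| = `|x|%N%:R :> C.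
Proof. by rewrite -intr_norm -abszE. Qed.

Lemma content_power_le m : (mx_content (A ^+ (d * m)) <= `|delta| ^ m)%N.
Proof.
have := content_det (A ^+ (d * m)); rewrite det_exp abszX mulnC expnM dvdn_pexp2r //.
by apply: dvdn_leq; rewrite expn_gt0 absz_gt0 delta_neq0.
Qed.

Lemma bernoulli_le (x : C) n : 0 <= x -> 1 + n%:R * x <= (1 + x) ^+ n.
Proof.
move=> x0; elim: n => [|n IHn]; first by rewrite mul0r addr0.
rewrite exprS; apply: le_trans (_ : (1 + x) * (1 + n%:R * x) <= _).
  have -> : (1 + x) * (1 + n%:R * x) = 1 + n.+1%:R * x + n%:R * x * x.
    by rewrite -natr1; ring.
  by rewrite lerDl !mulr_ge0.
by rewrite ler_wpM2l // addr_ge0.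
Qed.

Lemma growth_expanding i : 1 < `|beta i| ->
  exists Q K : nat, forall m,
    (mx_content (A ^+ (d * m)) ^ Q * 2 ^ m <= K * mx_size (A ^+ (d * m)) ^ Q)%N.
Proof.
move=> b1; have [K AK] := spectral_radius_bound.
pose x := `|beta i| - 1; have x0 : 0 < x by rewrite subr_gt0.
(* With Q >= 1 / (|beta i| - 1), Bernoulli gives |beta i|^Q >= 2. *)
have [Q Qx] := archi x^-1.
have Q2 : 2 <= `|beta i| ^+ Q.
  have -> : `|beta i| = 1 + x by rewrite addrC subrK.
  apply: le_trans (bernoulli_le _ (ltW x0)); rewrite -[2]/(1 + 1) lerD2l.
  by rewrite -ler_pdivrMr // div1r; apply: le_trans Qx; rewrite real_ler_norm ?gtr0_real ?invr_gt0.
exists Q, (K ^ Q)%N => m; rewrite -(ler_nat C) -expnMn !natrM !natrX.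
set r := mx_content _; apply: le_trans (_ : (r%:R * `|beta i| ^+ m) ^+ Q <= _).
  rewrite exprMn ler_wpM2l ?exprn_ge0 // -exprM mulnC exprM.
  by apply: lerXn2r; rewrite ?nnegrE ?exprn_ge0.
apply: lerXn2r; rewrite ?nnegrE ?mulr_ge0 ?exprn_ge0 //.
apply: le_trans (_ : (`|delta| ^ m)%N%:R * `|beta i| ^+ m <= _).
  by rewrite ler_wpM2r ?exprn_ge0 // ler_nat content_power_le.
rewrite natrM; apply: le_trans (AK (d * m)%N i).
by rewrite natrX -norm_intr_absz -exprMn -normrM mulrC divfK // -normrX -exprM.
Qed.

(* Over C this is delta ^ (d * 2 ^ j) * prod_i (X - (al i ^ d / delta) ^ (2 ^ j)). *)
Definition graeffe j : {poly int} := char_poly (A ^+ (d * 2 ^ j)) \Po ((delta ^+ (2 ^ j)) *: 'X).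

Lemma map_graeffe j : map_poly intr (graeffe j) =
  \prod_i ((delta%:~R ^+ (2 ^ j)) *: 'X - (al i ^+ (d * 2 ^ j))%:P) :> {poly C}.
Proof.
rewrite /graeffe map_comp_poly map_char_poly map_shiftX (char_poly_shiftX rt al_inj).
rewrite map_polyZ /= map_polyX rmorphXn /= rmorph_prod /=; apply: eq_bigr => i _.
by rewrite comp_polyB comp_polyX comp_polyC.
Qed.

Lemma lead_graeffe j : (graeffe j)`_d = delta ^+ (d * 2 ^ j).
Proof.
rewrite /graeffe coef_comp_scale; have /monicP := char_poly_monic (A ^+ (d * 2 ^ j)).
by rewrite lead_coefE size_char_poly /= => ->; rewrite mulr1 -exprM mulnC.
Qed.

(** Root squaring (Graeffe): doubling the exponent of A becomes a product of polynomials, to which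
    Gauss's lemma on contents applies. *)
Lemma graeffe_step j : graeffe j.+1 \Po 'X^2 = (-1) ^+ d *: (graeffe j * (graeffe j \Po ((-1) *: 'X))).
Proof.
apply: (@map_inj_poly _ _ (intr : int -> C)); first by apply: intr_inj.
  by [].
rewrite (map_comp_poly _ (graeffe j.+1)) map_polyXn map_polyZ /= rmorphM /=.
rewrite (map_comp_poly _ (graeffe j)) map_polyZ /= map_polyX.
rewrite !map_graeffe. rewrite (rmorph_prod (comp_poly ('X^2 : {poly C}))).
rewrite (rmorph_prod (comp_poly ((-1)%:~R *: 'X : {poly C}))) -big_split /=.
rewrite rmorphXn /= rmorphN1 -[RHS]mul_polyC polyC_exp.
have -> : (-1)%:P ^+ d = \prod_(i < d) (-1)%:P :> {poly C} by rewrite prodr_const card_ord.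
rewrite -big_split /=; apply: eq_bigr => i _.
rewrite !comp_polyB !comp_polyZ !comp_polyX !comp_polyC expnS [(2 * _)%N]mulnC mulnA !exprM.
set D := _ ^+ (2 ^ j); set a := (al i ^+ d) ^+ (2 ^ j).
by rewrite -!mul_polyC !polyC_exp !polyCN; ring.
Qed.

Lemma zcontents_negX (p : {poly int}) :
  (zcontents (p \Po ((-1) *: 'X)) %| zcontents p)%Z.
Proof.
rewrite dvdz_contents; apply/polyOverP => i.
have : (zcontents (p \Po (-1 *: 'X)) %| (p \Po (-1 *: 'X))`_i)%Z.
  by apply: (polyOverP _); rewrite -dvdz_contents.
by rewrite coef_comp_scale -signr_odd mulrC; case: odd; rewrite ?mulrN1 ?mulr1 ?rpredN.
Qed.

Lemma zcontents_graeffe j : (zcontents (graeffe j) %| zcontents (graeffe 0) ^+ (2 ^ j))%Z.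
Proof.
elim: j => [|j IHj]; first by rewrite expr1.
rewrite expnS mulnC exprM; apply: (@dvdz_trans (zcontents (graeffe j) ^+ 2)); last first.
  by rewrite !expr2; apply: dvdz_mul.
apply: (@dvdz_trans (zcontents (graeffe j.+1 \Po 'X^2))).
  rewrite dvdz_contents; apply/polyOverP => i.
  rewrite coef_comp_poly_Xn //; case: ifP => [_|]; last by rewrite dvdz0.
  by apply: (polyOverP _); rewrite -dvdz_contents.
rewrite graeffe_step zcontentsZ zcontentsM expr2.
apply: (@dvdz_trans ((-1) ^+ d * (zcontents (graeffe j) * zcontents (graeffe j)))).
  by do 2![apply: dvdz_mul => //]; apply: zcontents_negX.
by rewrite dvdzE !abszM abszX exp1n mul1n.
Qed.

(** If A^(d 2^j) = r Y, then r^d divides its determinant, so r divides delta^(2^j) as well; with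
    matrix and variable both scaled by r, a factor r^d leaves the characteristic polynomial. *)
Lemma content_dvd_graeffe j :
  ((mx_content (A ^+ (d * 2 ^ j)))%:Z ^+ d %| zcontents (graeffe j))%Z.
Proof.
set r := mx_content _; have [Y XY] := content_factor (A ^+ (d * 2 ^ j)).
have [e De] : exists e, delta ^+ (2 ^ j) = r%:Z * e.
  have : (r%:Z %| delta ^+ (2 ^ j))%Z.
    have := content_det (A ^+ (d * 2 ^ j)).
    by rewrite -/r det_exp abszX mulnC expnM dvdn_pexp2r // dvdzE abszX.
  by move/dvdzP=> [e ->]; exists e; rewrite mulrC.
rewrite dvdz_contents; apply/polyOverP => i.
have -> : graeffe j = r%:Z ^+ d *: (char_poly Y \Po (e *: 'X)).
  rewrite /graeffe {1}XY De -/r -comp_polyZ -char_polyZ -comp_polyA.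
  by rewrite comp_polyZ comp_polyX scalerA.
by rewrite coefZ dvdz_mulr.
Qed.

Lemma content_add m n : (mx_content (A ^+ m) * mx_content (A ^+ n) <= mx_content (A ^+ (m + n)))%N.
Proof.
apply: dvdn_leq; last by rewrite exprD; apply: content_mulmx.
rewrite lt0n; apply/eqP => c0; have := content_det (A ^+ (m + n)).
rewrite c0 exp0n // dvd0n det_exp absz_eq0 expf_eq0 (negbTE delta_neq0) andbF.
by [].
Qed.

Lemma content_pow_le m t n :
  (mx_content (A ^+ m) ^ t * mx_content (A ^+ n) <= mx_content (A ^+ (m * t + n)))%N.
Proof.
elim: t => [|t IHt]; first by rewrite expn0 muln0 add0n mul1n.
rewrite expnS mulnS -addnA; apply: leq_trans (content_add _ _).
by rewrite -mulnA leq_mul2l IHt orbT.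
Qed.

Lemma content_gt0 m : (0 < mx_content (A ^+ m))%N.
Proof.
rewrite lt0n; apply/eqP => c0; have := content_det (A ^+ m).
rewrite c0 exp0n // dvd0n det_exp absz_eq0 expf_eq0 (negbTE delta_neq0) andbF.
by [].
Qed.

Lemma mx_size_det m : (`|delta| ^ (d * m) <= d`! * mx_size (A ^+ (d * m)) ^ d)%N.
Proof.
have := absz_det_le (fun i j => absz_le_mx_size (A ^+ (d * m)) i j).
by rewrite det_exp abszX.
Qed.

(** The content of [graeffe 0] divides |delta|^d properly, so it is at most half of it. Squaring
    turns this into a saving of 2^(2^j) in the content of A^(d 2^j), whereas the determinant forces
    the size to be at least of order |delta|^(2^j). *)
Lemma growth_nonintegral : (`|zcontents (graeffe 0)| < `|delta| ^ d)%N ->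
  exists Q K : nat, forall m,
    (mx_content (A ^+ (d * m)) ^ Q * 2 ^ m <= K * mx_size (A ^+ (d * m)) ^ Q)%N.
Proof.
set g := `|zcontents _|%N => ltg.
have g_gt0 : (0 < g)%N.
  rewrite absz_gt0 zcontents_eq0; apply/eqP => G0.
  have := lead_graeffe 0; rewrite G0 coef0 => /esym/eqP.
  by rewrite expf_eq0 (negbTE delta_neq0) andbF.
have g2 : (2 * g <= `|delta| ^ d)%N.
  have /dvdnP[k e] : (g %| `|delta| ^ d)%N.
    rewrite -abszX -[X in (delta ^+ X)%N](muln1 d) -[X in (d * X)%N](expn0 2) -(lead_graeffe 0).
    have : (zcontents (graeffe 0) %| (graeffe 0)`_d)%Z.
      by apply: (polyOverP _); rewrite -dvdz_contents.
    by rewrite dvdzE.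
  by move: ltg; rewrite e; case: k {e} => [|[|k]]; nia.
have dyadic j : (2 ^ (2 ^ j) * mx_content (A ^+ (d * 2 ^ j)) ^ d <= `|delta| ^ (d * 2 ^ j))%N.
  have le1 : (mx_content (A ^+ (d * 2 ^ j)) ^ d <= g ^ (2 ^ j))%N.
    apply: dvdn_leq; first by rewrite expn_gt0 g_gt0.
    have := dvdz_trans (content_dvd_graeffe j) (zcontents_graeffe j).
    by rewrite dvdzE !abszX.
  apply: (@leq_trans ((2 * g) ^ (2 ^ j))); first by rewrite expnMn leq_mul2l le1 orbT.
  by rewrite expnM leq_exp2r // expn_gt0.
exists d, d`! => m; apply: leq_trans (mx_size_det m).
have [->|m0] := posnP m.
  have := content_power_le 0; rewrite muln0 !expn0 muln1.
  by case: (mx_content _) => [|[|r]] // _; rewrite ?exp0n ?exp1n.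
(* The content bound is known only at exponents d * 2^J. Supermultiplicativity of the content
   compares m with 2^J = m t + k, k < m; the leftover |delta|^(d k) is bounded independently of
   t. *)
rewrite mulnC; apply: (@leq_of_powers _ _ (`|delta| ^ (d * m))) => T.
pose J := (m * T)%N; pose t := (2 ^ J %/ m)%N; pose k := (2 ^ J %% m)%N.
have tk : (2 ^ J = m * t + k)%N by rewrite mulnC; apply: divn_eq.
have ltk : (k < m)%N by rewrite ltn_mod.
exists t; first by rewrite leq_divRL // mulnC ltnW // ltn_expl.
have delta0 : (0 < `|delta|)%N by rewrite absz_gt0 delta_neq0.
have le_r : (mx_content (A ^+ (d * m)) ^ t <= mx_content (A ^+ (d * 2 ^ J)))%N.
  rewrite tk mulnDr mulnA; apply: leq_trans (content_pow_le _ _ _).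
  by rewrite leq_pmulr ?content_gt0.
apply: (@leq_trans (`|delta| ^ (d * 2 ^ J))).
  apply: leq_trans (dyadic J); rewrite expnMn -!expnM leq_mul //.
    by rewrite leq_pexp2l // tk leq_addr.
  by rewrite [(d * t)%N]mulnC expnM leq_exp2r.
rewrite tk mulnDr expnD mulnA expnM [leqLHS]mulnC leq_mul2r; apply/orP; right.
by rewrite leq_pexp2l // leq_mul2l ltnW ?orbT.
Qed.

(* Kronecker's argument: if al j ^ d / delta are algebraic integers in the
   closed unit disk, then the powers of their companion matrix are bounded
   integer matrices, hence repeat. *)
Lemma graeffe_integral_false : (forall i, `|beta i| <= 1) ->
  `|zcontents (graeffe 0)|%N = (`|delta| ^ d)%N -> False.
Proof.
move=> b1 eg; pose P := \prod_i ('X - (beta i)%:P) : {poly C}.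
have mG : map_poly intr (graeffe 0) = (delta%:~R ^+ d) *: P.
  rewrite map_graeffe expn0 expr1 muln1 -[RHS]mul_polyC polyC_exp.
  have -> : (delta%:~R)%:P ^+ d = \prod_(i < d) (delta%:~R)%:P :> {poly C}.
    by rewrite prodr_const card_ord.
  rewrite -big_split /=; apply: eq_bigr => i _.
  by rewrite mulrBr mul_polyC -polyCM /beta mulrCA divff // mulr1.
have [p [pmon pP]] : exists p : {poly int}, p \is monic /\ map_poly intr p = P.
  have z0 : zcontents (graeffe 0) = delta ^+ d \/ zcontents (graeffe 0) = - delta ^+ d.
    have : (`|zcontents (graeffe 0)| = `|delta ^+ d|)%N by rewrite abszX.
    lia.
  have {z0} [q qG] : exists q, graeffe 0 = delta ^+ d *: q.
    by rewrite [graeffe 0]zpolyEprim; case: z0 => ->;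
      [exists (zprimitive (graeffe 0)) | exists (- zprimitive (graeffe 0)); rewrite scalerN scaleNr].
  have qP : map_poly intr q = P.
    apply: (@scalerI _ _ (delta%:~R ^+ d : C)); first by rewrite expf_neq0.
    by rewrite -mG qG map_polyZ /= rmorphXn.
  exists q; split => //; rewrite monicE -(eqr_int C).
  have := lead_coef_map_inj (intr_inj : injective (intr : int -> C)) (rmorph0 _) q.
  move=> <-; rewrite qP; apply/eqP/monicP; apply: monic_prod => i _; exact: monicXsubC.
have szp : size p = d.+1.
  rewrite -(size_map_inj_poly (intr_inj : injective (intr : int -> C))) // pP size_prod_XsubC.
  by rewrite /index_enum -enumT size_enum_ord.
pose c' k : int := - p`_k.
have brt j : beta j ^+ d = \sum_(i < d) (c' i)%:~R * beta j ^+ i.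
  have : P.[beta j] = 0.
    by rewrite /P horner_prod (bigD1 j) //= hornerXsubC subrr mul0r.
  rewrite -pP horner_coef size_map_inj_poly //; last by apply: intr_inj.
  rewrite szp big_ord_recr /= !coef_map /=.
  have -> : p`_d = 1 by have /monicP := pmon; rewrite lead_coefE szp.
  rewrite mul1r => /eqP; rewrite addrC addr_eq0 => /eqP ->.
  by rewrite -sumrN; apply: eq_bigr => i _; rewrite coef_map /c' /= rmorphN mulNr.
have [_ _ powinj] := spec.
have binj : injective beta.
  move=> i j; rewrite /beta => e; apply: (powinj d isT) => /=.
  by apply: (mulIf (_ : delta%:~R^-1 != 0)); rewrite ?invr_eq0.
set V := vander beta; have VU : V \in unitmx := vander_unit binj.
have [K1 VK1] := bounded_family (fun k : 'I_d * 'I_d => invmx V k.1 k.2).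
have [K2 VK2] := bounded_family (fun k : 'I_d * 'I_d => V k.1 k.2).
pose B := shift_mx d c'; pose K := (d * (K2 * K1))%N.
have powB n : map_mx intr (B ^+ n) = V *m diag_mx (\row_j beta j ^+ n) *m invmx V :> 'M[C]_d.
  by rewrite map_mxXn map_shift_mx (shiftX_diag brt binj).
have bdB n i j : (`|(B ^+ n) i j| <= K)%N.
  rewrite -(ler_nat C) -norm_intr_absz.
  have -> : ((B ^+ n) i j)%:~R = (map_mx intr (B ^+ n) : 'M[C]_d) i j by rewrite mxE.
  rewrite powB mul_mx_diag mxE; apply: le_trans (ler_norm_sum _ _ _) _.
  apply: le_trans (_ : \sum_(k < d) (K2 * K1)%:R <= _); last first.
    by rewrite sumr_const card_ord /K -[leLHS]mulr_natl -natrM.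
  apply: ler_sum => k _; rewrite [X in X * _]mxE !normrM natrM.
  apply: ler_pM => //; rewrite ?mulr_ge0 //; last exact: VK1 (k, j).
  rewrite -[K2%:R]mulr1; apply: ler_pM => //; first exact: VK2 (i, k).
  by rewrite mxE normrX exprn_ile1.
pose T : finType := {ffun 'I_d * 'I_d -> 'I_(K + K).+1}.
pose F (n : 'I_(#|T|.+1)) : T := [ffun k => inord (absz ((B ^+ n) k.1 k.2 + K%:Z))].
have : ~~ injectiveb F by apply/injectiveP => /leq_card; rewrite card_ord ltnn.
case/injectivePn => n [m nnm eF].
wlog ltnm : n m nnm eF / (n < m)%N.
  move=> W; have := nnm; case: (ltngtP n m) => [lt _|gt _|/val_inj->]; last by rewrite eqxx.
    exact: W nnm eF lt.
  by apply: (W m n) => //; rewrite eq_sym.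
have eB : B ^+ n = B ^+ m.
  apply/matrixP => i j; have := congr1 (fun f : T => f (i, j) : nat) eF.
  have [ltn_ injn] := absz_shift_inj (bdB n i j) (bdB m i j).
  have [ltm_ _] := absz_shift_inj (bdB m i j) (bdB n i j).
  by rewrite !ffunE /= !inordK.
have eb i : beta i ^+ n = beta i ^+ m.
  have : V *m diag_mx (\row_j beta j ^+ n) *m invmx V = V *m diag_mx (\row_j beta j ^+ m) *m invmx V.
    by rewrite -!powB eB.
  move/(congr1 (fun M => invmx V *m M *m V)); rewrite -!mulmxA !mulVmx // !mulmx1 !mulKmx //.
  by move/(congr1 (fun M : 'M[C]_d => M i i)); rewrite !mxE eqxx !mulr1n.
have b0 i : beta i != 0 by rewrite mulf_neq0 ?invr_eq0 ?expf_neq0.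
pose L := (m - n)%N; have L0 : (0 < L)%N by rewrite subn_gt0.
have bL i : beta i ^+ L = 1.
  apply: (mulIf (expf_neq0 n (b0 i))); rewrite mul1r -exprD subnK ?(ltnW ltnm) //.
have aL i : al i ^+ (d * L) = delta%:~R ^+ L.
  apply: (mulIf (_ : delta%:~R ^- L != 0)); first by rewrite invr_eq0 expf_neq0.
  by rewrite divff ?expf_neq0 // -[RHS](bL i) /beta expr_div_n exprM.
have dL : (0 < d * L)%N by rewrite muln_gt0 L0.
(* All al i ^ (d * L) coincide, but 0 and [ord_max] are distinct indices because d >= 2. *)
have := powinj _ dL 0 ord_max; rewrite /= !aL => /(_ erefl) /(congr1 (@nat_of_ord _)) /= e.
by move: d'_gt0; rewrite -e.
Qed.

(** Either some |beta i| exceeds 1, or all are at most 1 and Kronecker's argument excludes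
    integrality. An exponent that is not a multiple of d is rounded up at the cost of the constant
    [Z]. *)
Lemma height_growth : exists Q K : nat, forall m,
  (mx_content (A ^+ m) ^ Q * 2 ^ m <= K * mx_size (A ^+ m) ^ Q)%N.
Proof.
have [Q [K QK]] : exists Q K : nat, forall m,
    (mx_content (A ^+ (d * m)) ^ Q * 2 ^ m <= K * mx_size (A ^+ (d * m)) ^ Q)%N.
  have [[i bi]|nb] := pselect (exists i, 1 < `|beta i|); first exact: growth_expanding bi.
  have b1 i : `|beta i| <= 1.
    by rewrite real_leNgt ?normr_real ?real1 //; apply/negP => lt; apply: nb; exists i.
  apply: growth_nonintegral; rewrite ltn_neqAle; apply/andP; split.
    by apply/eqP => e; apply: (graeffe_integral_false b1 e).
  apply: dvdn_leq; first by rewrite expn_gt0 absz_gt0 delta_neq0.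
  have : (zcontents (graeffe 0) %| (graeffe 0)`_d)%Z.
    by apply: (polyOverP _); rewrite -dvdz_contents.
  by rewrite lead_graeffe muln1 dvdzE abszX.
pose B := (mx_size A + mx_size (1 : 'M[int]_d))%N.
have powB n : (mx_size (A ^+ n) <= B ^ n.+1)%N by apply: mx_sizeX; rewrite /B; lia.
have B0 : (0 < B)%N.
  rewrite /B addn_gt0; apply/orP; right; apply: leq_trans (absz_le_mx_size 1 0 0).
  by rewrite mxE eqxx.
pose Z := (B ^ d.+1)%N; exists (Q * d)%N, (K ^ d * Z ^ (Q * d))%N => m.
pose m' := (m %/ d).+1.
have lemm : (m <= d * m')%N by rewrite mulnC ltnW // ltn_ceil.
have lem'm : (d * m' - m <= d)%N.
  by rewrite /m' mulnS {2}(divn_eq m d) [(m %/ d * d)%N]mulnC; lia.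
have le_r : (mx_content (A ^+ m) <= mx_content (A ^+ (d * m')))%N.
  rewrite -(subnKC lemm); apply: leq_trans (content_add _ _).
  by rewrite leq_pmulr ?content_gt0.
have le_N : (mx_size (A ^+ (d * m')) <= mx_size (A ^+ m) * Z)%N.
  rewrite -(subnKC lemm) exprD; apply: leq_trans (mx_sizeM _ _) _.
  rewrite leq_mul2l; apply/orP; right; apply: leq_trans (powB _) _.
  by rewrite leq_pexp2l // ltnS.
apply: (@leq_trans ((mx_content (A ^+ (d * m')) ^ Q * 2 ^ m') ^ d)).
  rewrite expnMn -!expnM leq_mul //; last by rewrite leq_pexp2l // mulnC.
  by have [->|Qd0] := posnP (Q * d); rewrite ?expn0 // leq_exp2r.
apply: (@leq_trans ((K * mx_size (A ^+ (d * m')) ^ Q) ^ d)); first by rewrite leq_exp2r.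
rewrite expnMn -expnM -mulnA leq_mul2l -expnMn [(Z * _)%N]mulnC; apply/orP; right.
by have [->|Qd0] := posnP (Q * d); rewrite ?expn0 // leq_exp2r.
Qed.

End Height.

(** * Parts of the terms prime to the constant coefficient *)

Lemma count_fibers (T : finType) (f : nat -> T) (s : seq nat) K :
  (forall t, (size [seq n <- s | f n == t] <= K)%N) -> (size s <= #|T| * K)%N.
Proof.
move=> fK; rewrite -sum1_size (partition_big f xpredT) //=.
rewrite -sum_nat_const; apply: leq_sum => t _.
by rewrite -big_filter sum1_size.
Qed.

Lemma prod_primes_logn n : (0 < n)%N -> n = (\prod_(p <- primes n) p ^ logn p n)%N.
Proof.
by move=> n0; rewrite {1}(prod_prime_decomp n0) prime_decompE big_map.
Qed.

Lemma prod_logn_dvd (P : seq nat) (e : nat -> nat) n : uniq P -> all prime P -> (0 < n)%N ->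
  {in P, forall p, (e p <= logn p n)%N} -> (\prod_(p <- P) p ^ e p %| n)%N.
Proof.
move=> UP prP n0; elim: P UP prP => [|p P IHP] /=; first by rewrite big_nil dvd1n.
move=> /andP[pP UP] /andP[pr_p prP] le; rewrite big_cons Gauss_dvd; last first.
  rewrite coprimeXl // big_seq; elim/big_ind: _ => [|a b ca cb|q qP].
  - exact: coprimen1.
  - by rewrite coprimeMr ca.
  have pr_q := allP prP q qP; rewrite coprimeXr // prime_coprime // dvdn_prime2 //.
  by apply: contraNneq pP => e_pq; move: qP; rewrite -e_pq.
rewrite IHP // ?andbT; last by move=> q qP; apply: le; rewrite inE qP orbT.
by rewrite pfactor_dvdn // le // mem_head.
Qed.

Definition free_part (D n : nat) : nat := (\prod_(p <- primes n | p \notin primes D) p ^ logn p n)%N.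

Lemma free_partE D n : (0 < n)%N ->
  n = (\prod_(p <- primes D) p ^ logn p n * free_part D n)%N.
Proof.
move=> n0; rewrite {1}(prod_primes_logn n0) (bigID (fun p => p \in primes D)) /=; congr (_ * _)%N.
rewrite [RHS](bigID (fun p => p \in primes n)) /= [X in (_ * X)%N]big1 ?muln1; last first.
  by move=> p pn; rewrite lognE; case: ifP pn => // /and3P[pr_p _ dv]; rewrite mem_primes pr_p n0 dv.
rewrite -big_filter -[RHS]big_filter; apply: perm_big.
apply: uniq_perm; rewrite ?filter_uniq ?primes_uniq // => p.
by rewrite !mem_filter andbC.
Qed.

Lemma mx_contentZ m n (a : int) (X : 'M[int]_(m, n)) :
  mx_content (a *: X) = (`|a| * mx_content X)%N.
Proof.
rewrite /mx_content (big_morph (muln `|a|%N) (muln_gcdr `|a|%N) (muln0 _)).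
by apply: eq_bigr => k _; rewrite mxE abszM.
Qed.

Definition independence_bound d' (c : nat -> int) (N K : nat) :=
  forall y (s : seq nat), (y <= N)%N -> uniq s -> {in s, forall n, (n < y)%N} ->
  (K < size s)%N -> exists2 h : 'I_d'.+1 -> nat, forall i, h i \in s & \det (orbit_mx c h) != 0.

Lemma window_independent d' (c : nat -> int) N K x y (s : seq nat) : independence_bound d' c N K -> (y <= N)%N ->
  uniq s -> {in s, forall n, (x <= n < x + y)%N} -> (K < size s)%N ->
  exists h : 'I_d'.+1 -> nat, [/\ forall i, (x + h i)%N \in s, forall i, (h i < y)%N
    & \det (orbit_mx c h) != 0].
Proof.
move=> indep leyN Us sx ltK.
have [|n /mapP[m ms ->]||h hs dh] := indep y [seq (n - x)%N | n <- s] leyN.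
- rewrite map_inj_in_uniq // => m n /sx/andP[lm _] /sx/andP[ln _] /eqP.
  by rewrite eqn_sub2rE // => /eqP.
- by have := sx m ms; lia.
- by rewrite size_map.
exists h; split => // i; have /mapP[m ms e] := hs i; have := sx m ms; last by lia.
by move=> ?; have -> : (x + h i = m)%N by lia.
Qed.

Section FreePart.
Variables (C : numClosedFieldType) (d' : nat).
Let d := d'.+1.
Variables (u : nat -> int) (c : nat -> int) (al : 'I_d -> C).
Hypothesis archi : forall x : C, exists n : nat, `|x| <= n%:R.
Hypothesis lin : linear_recurrence u d c.
Hypothesis spec : nondegenerate_spectrum c al.
Hypothesis d'_gt0 : (0 < d')%N.
Let A := shift_mx d c.
Let rec : satisfies_recurrence u d c.
Proof. by case: lin. Qed.
Let D := `|\det A|%N.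

Lemma orbit_const_neq0 (h : 'I_d -> nat) : \det (orbit_mx c h) != 0 -> orbit_const u c h != 0.
Proof. by move=> h0; rewrite mulf_neq0 // (det_hankel_neq0 lin). Qed.

(** The valuations at primes dividing det A are sorted into boxes of width x / Q. More than K terms
    in one box contain d independent ones, which share a divisor [rs] and exceed it only by a small
    factor. Then [rs] nearly divides A^(x - 1), whose size is nearly bounded by [rs], against
    [height_growth]. *)
Lemma few_small_free_parts : exists Q X0 B0 : nat, (0 < Q)%N /\ forall N K x y (s : seq nat),
  independence_bound d' c N K -> (y <= N)%N -> (Q * y <= x)%N -> (X0 < x)%N ->
  uniq s -> {in s, forall n, (x <= n < x + y)%N} ->
  {in s, forall n, u n != 0 /\ (free_part D `|u n| ^ Q < 2 ^ x)%N} ->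
  (size s <= B0 * K)%N.
Proof.
have [Qh [Kh growth]] := height_growth archi spec d'_gt0.
have [K [K1 _ uK ocK obsK]] := size_bounds rec.
pose P := primes D; pose Rd := (\prod_(p <- P) p)%N.
have Rd0 : (0 < Rd)%N by rewrite /Rd big_seq prodn_cond_gt0 // => p; rewrite mem_primes => /andP[/prime_gt0].
(* The lengths y and w and the binary logarithm of [qm] are at most x / Q, so the power Q * Qh of
   [Z] costs 2^(x * W) and a constant. Q = W + 1 then leaves x <= X0, a contradiction. *)
pose W := (Qh * (2 * K + 2 * Rd + 1))%N; pose Q := W.+1.
pose c1 := (Kh * (d * d) ^ Qh * K ^ (2 * Qh))%N.
pose X0 := (Q * (1 + c1))%N; pose Bk := (3 * K * Q)%N.
pose T : finType := {ffun 'I_(size P) -> 'I_Bk.+1}.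
exists Q, X0, #|T|; split=> // N K' x y s indep leyN leQy ltX0 Us sx su.
have x0 : (0 < x)%N by apply: leq_ltn_trans ltX0.
pose v p n := logn p `|u n|%N.
pose f n : T := [ffun k : 'I_(size P) => inord (v (nth 0%N P k) n * Q %/ x)].
apply: (count_fibers (f := f)) => t; rewrite leqNgt; apply/negP => ltK'.
set s' := [seq _ <- _ | _] in ltK'.
have s's : {subset s' <= s} by move=> n; rewrite mem_filter => /andP[].
have [|n /s's/sx //|h [hs hy dh]] := window_independent (s := s') (x := x) indep leyN _ _ ltK'.
  exact: filter_uniq.
have hin i : (x + h i)%N \in s by apply: s's.
have v_bound p n : n \in s -> p \in P -> (v p n <= K * n.+1)%N.
  move=> ns; rewrite mem_primes => /andP[pr_p _]; have [u0 _] := su n ns.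
  rewrite -(leq_exp2l (m := 2)) //; apply: (@leq_trans (p ^ v p n)).
    by have [->|v0] := posnP (v p n); [rewrite !expn0 | rewrite leq_exp2r ?prime_gt1].
  apply: (@leq_trans `|u n|); first by apply: dvdn_leq; rewrite ?absz_gt0 // pfactor_dvdnn.
  apply: leq_trans (uK n _) _; first by have := sx n ns; lia.
  by rewrite expnM leq_exp2r // ltnW // ltn_expl.
have same i j p : p \in P -> (v p (x + h i) <= v p (x + h j) + x %/ Q)%N.
  move=> pP; have ltp : (index p P < size P)%N by rewrite index_mem.
  have fE k : (f (x + h k)%N (Ordinal ltp) = v p (x + h k) * Q %/ x :> nat)%N.
    rewrite ffunE inordK nth_index // ltnS /Bk.
    have := v_bound p _ (hin k) pP; have := sx _ (hin k) => lt1 lt2.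
    have : (v p (x + h k) <= K * (3 * x))%N by apply: leq_trans lt2 _; rewrite leq_mul2l; nia.
    move=> le3; rewrite -(mulnK (3 * K * Q) x0); apply: leq_div2r.
    have -> : (3 * K * Q * x = K * (3 * x) * Q)%N by ring.
    by rewrite leq_mul2r le3 orbT.
  have : f (x + h i)%N = f (x + h j)%N.
    by have := hs i; have := hs j; rewrite !mem_filter => /andP[/eqP-> _] /andP[/eqP-> _].
  move/(congr1 (fun g : T => g (Ordinal ltp) : nat)); rewrite !fE => e.
  rewrite -leq_subLR leq_divRL //.
  have := leq_divM (v p (x + h j) * Q) x.
  have := ltn_ceil (v p (x + h i) * Q) x0; rewrite e mulSn => l1 l2.
  by rewrite mulnBl; lia.
pose i0 : 'I_d := ord0; pose w := (x %/ Q)%N.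
(* Lowering the valuations at one term by the box width w makes them lower bounds at all terms; at
   most 2 w is lost per prime, whence [Rd ^ (2 * w)]. *)
pose e p := (v p (x + h i0) - w)%N; pose rs := (\prod_(p <- P) p ^ e p)%N.
pose q i := free_part D `|u (x + h i)%N|; pose qm := (\max_i q i)%N.
have un0 i : (0 < `|u (x + h i)|)%N by rewrite absz_gt0; case: (su _ (hin i)).
have qmQ : (qm ^ Q <= 2 ^ x)%N.
  have [i ->] : exists i, qm = q i.
    by have [|i ei] := @bigop.eq_bigmax 'I_d q; [rewrite card_ord | exists i].
  by apply: ltnW; case: (su _ (hin i)).
have prP : all prime P by apply/allP => p; rewrite mem_primes => /andP[].
have rs_dvd i : (rs %| `|u (x + h i)|)%N.
  apply: prod_logn_dvd => //; first exact: primes_uniq.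
  by move=> p pP; have := same i0 i p pP; rewrite /e /w /v; lia.
pose X := (rs * Rd ^ (2 * w) * qm)%N.
have uX i : (`|u (x + h i)| <= X)%N.
  rewrite (free_partE D (un0 i)); apply: leq_mul; last exact: bigop.leq_bigmax.
  rewrite (big_morph (expn^~ (2 * w)%N) (fun a b => expnMn a b _) (exp1n _)) /= -big_split /=.
  rewrite big_seq [leqRHS]big_seq; apply: leq_prod => p pP.
  rewrite -expnD leq_pexp2l ?prime_gt0 ?(allP prP) //.
  by have := same i i0 p pP; rewrite /e -/w /v; lia.
have oc0 := orbit_const_neq0 dh; set oc := orbit_const u c h in oc0.
have leh i : (h i <= y)%N by apply: ltnW.
set M := A ^+ x.-1; set ct := mx_content M.
have rs_le : (rs <= K ^ y.+1 * ct)%N.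
  apply: (@leq_trans (`|oc| * ct)); last by rewrite leq_mul2r ocK ?orbT.
  apply: dvdn_leq; first by rewrite muln_gt0 absz_gt0 oc0 (content_gt0 spec).
  rewrite -mx_contentZ; apply/dvdn_content => i j; rewrite mxE.
  by apply: (dvd_shiftX_observed rec x0) => k; rewrite dvdzE.
have sz_le : (mx_size M <= d * d * (K ^ y.+1 * X))%N.
  apply: mx_size_le => i j; apply: leq_trans (obsK h x y X x0 leh uX i j).
  by rewrite abszM leq_pmull // absz_gt0.
pose Z := (d * d * (K ^ y.+1 * K ^ y.+1 * Rd ^ (2 * w) * qm))%N.
have szZ : (mx_size M <= ct * Z)%N.
  apply: leq_trans sz_le _; rewrite /Z /X.
  have eqn_ (a ka rd : nat) : (ct * (a * (ka * ka * rd * qm)) = a * (ka * ((ka * ct) * rd * qm)))%N.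
    by ring.
  by rewrite eqn_ !leq_mul.
have ct0 : (0 < ct)%N := content_gt0 spec _.
have le2 : (2 ^ x.-1 <= Kh * Z ^ Qh)%N.
  have ctQ : (0 < ct ^ Qh)%N by rewrite expn_gt0 ct0.
  rewrite -(leq_pmul2l ctQ); apply: leq_trans (growth x.-1) _.
  rewrite mulnCA leq_mul2l -expnMn; apply/orP; right.
  by have [->|Qh0] := posnP Qh; [rewrite !expn0 | rewrite leq_exp2r].
have ZQ : (Z ^ Q <= (d * d * (K * K)) ^ Q * 2 ^ (x * (2 * K + 2 * Rd + 1)))%N.
  have -> : (Z = d * d * (K * K) * (K ^ (2 * y) * Rd ^ (2 * w) * qm))%N.
    have eqn_ (a ka rd : nat) : (a * (K * ka * (K * ka) * rd * qm) = a * (K * K) * (ka * ka * rd * qm))%N.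
      by ring.
    by rewrite /Z !expnS eqn_ [(2 * y)%N]mul2n -addnn expnD.
  rewrite expnMn leq_mul2l; apply/orP; right.
  rewrite !expnMn -!expnM mulnDr muln1 expnD mulnDr expnD.
  apply: leq_mul => //; apply: leq_mul.
    apply: (@leq_trans ((2 ^ K) ^ (2 * x))); last by rewrite -expnM; apply: eq_leq; congr (_ ^ _)%N; ring.
    apply: (@leq_trans (K ^ (2 * x))); first by rewrite leq_pexp2l ?(ltnW K1) // -mulnA leq_mul2l mulnC.
    by rewrite leq_exp2r ?muln_gt0 // ltnW // ltn_expl.
  apply: (@leq_trans ((2 ^ Rd) ^ (2 * x))); last by rewrite -expnM; apply: eq_leq; congr (_ ^ _)%N; ring.
  apply: (@leq_trans (Rd ^ (2 * x))); last by rewrite leq_exp2r ?muln_gt0 // ltnW // ltn_expl.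
  by rewrite leq_pexp2l // -mulnA leq_mul2l leq_divM.
have : (2 ^ (x.-1 * Q) <= 2 ^ (c1 * Q + x * W))%N.
  rewrite expnM; apply: (@leq_trans ((Kh * Z ^ Qh) ^ Q)); first by rewrite leq_exp2r.
  rewrite expnMn expnAC.
  apply: (@leq_trans (Kh ^ Q * ((d * d * (K * K)) ^ Q * 2 ^ (x * (2 * K + 2 * Rd + 1))) ^ Qh)).
    rewrite leq_mul2l; apply/orP; right.
    by have [->|Qh0] := posnP Qh; [rewrite !expn0 | rewrite leq_exp2r].
  rewrite expnMn mulnA -[((2 ^ _) ^ Qh)%N]expnM expnD.
  have -> : (x * (2 * K + 2 * Rd + 1) * Qh = x * W)%N by rewrite /W; ring.
  rewrite leq_mul2r; apply/orP; right.
  rewrite expnAC -expnMn [(2 ^ _)%N]expnM leq_exp2r //.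
  apply: leq_trans (ltnW (ltn_expl c1 (leqnn 2))).
  by rewrite /c1 [(K ^ _)%N]expnM -[leqRHS]mulnA -[((d * d) ^ _ * _)%N]expnMn -[(K ^ 2)%N]mulnn.
rewrite leq_exp2l // => le3.
have : (x * Q <= c1 * Q + x * W + Q)%N by rewrite -(prednK x0) mulSn; move: le3; rewrite prednK //; lia.
by move: ltX0; rewrite /X0 /Q; nia.
Qed.

End FreePart.

(** * Bad primes *)

Lemma size_primes_le n k : (n <= 2 ^ k)%N -> (size (primes n) <= k)%N.
Proof.
have [->//|n0] := posnP n; move=> le; rewrite -(leq_exp2l (m := 2)) //; apply: leq_trans le.
have -> : (2 ^ size (primes n) = \prod_(p <- primes n) 2)%N.
  by rewrite big_const_seq count_predT iter_muln_1.
rewrite [leqRHS](prod_primes_logn n0) big_seq [leqRHS]big_seq; apply: leq_prod => p pn.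
have lg : (0 < logn p n)%N by rewrite logn_gt0.
have p2 : (2 <= p)%N by move: pn; rewrite mem_primes => /andP[/prime_gt1].
apply: leq_trans p2 _; apply: (@leq_trans (p ^ 1)); first by rewrite expn1.
by rewrite leq_pexp2l ?lg ?(ltnW p2) //; move: pn; rewrite mem_primes => /andP[/prime_gt0].
Qed.

Section BadPrimes.
Variables (C : numClosedFieldType) (d' : nat).
Let d := d'.+1.
Variables (u : nat -> int) (c : nat -> int) (al : 'I_d -> C).
Hypothesis archi : forall x : C, exists n : nat, `|x| <= n%:R.
Hypothesis lin : linear_recurrence u d c.
Hypothesis spec : nondegenerate_spectrum c al.
Hypothesis d'_gt0 : (0 < d')%N.
Let A := shift_mx d c.
Let rec : satisfies_recurrence u d c.
Proof. by case: lin. Qed.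
Let D := `|\det A|%N.
Let Delta := `|\det (hankel_mx d' u 1)|%N.

(* Times in [0, H), the one of index k.1 being 0. *)
Definition anchored H (k : 'I_d * {ffun 'I_d' -> 'I_H}) (i : 'I_d) : nat :=
  if unlift k.1 i is Some j then k.2 j else 0%N.

(** Anchoring one time at 0 leaves d * H^(d - 1) tuples with O(H) primes each, which saves a factor
    H. A singular tuple contributes nothing, as [primes 0] is empty. *)
Definition bad_primes H : seq nat :=
  primes D ++ primes Delta ++
  flatten [seq primes `|\det (orbit_mx c (anchored k))| | k <- enum {: 'I_d * {ffun 'I_d' -> 'I_H}}].

Lemma D_gt0 : (0 < D)%N.
Proof. by rewrite absz_gt0 (det_shift_neq0 spec). Qed.

Lemma size_bad_primes : exists B, forall H, (0 < H)%N -> (size (bad_primes H) <= B * H ^ d)%N.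
Proof.
have [K [K1 _ _ ocK _]] := size_bounds rec.
exists (D + Delta + 2 * d * K)%N => H H0.
have le1 n : (size (primes n) <= n)%N by apply: size_primes_le; apply/ltnW/ltn_expl.
have Hd : (0 < H ^ d)%N by rewrite expn_gt0 H0.
rewrite /bad_primes !size_cat size_flatten /shape -map_comp sumnE big_map big_enum /=.
rewrite addnA mulnDl; apply: leq_add.
  apply: (@leq_trans (D + Delta)); first by rewrite leq_add.
  by rewrite leq_pmulr.
apply: (@leq_trans (\sum_(k : 'I_d * {ffun 'I_d' -> 'I_H}) K * H.+1)%N).
  apply: leq_sum => k _; apply: size_primes_le.
  have [->|dn0] := eqVneq (\det (orbit_mx c (anchored k))) 0; first by [].
  apply: (@leq_trans `|orbit_const u c (anchored k)|%N).
    by rewrite abszM leq_pmulr // absz_gt0 (det_hankel_neq0 lin).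
  apply: leq_trans (ocK _ H _) _.
    by move=> i; rewrite /anchored; case: unliftP => [j _|_]; rewrite ?(ltnW (ltn_ord _)).
  by rewrite expnM leq_exp2r // ltnW // ltn_expl.
rewrite sum_nat_const card_prod card_ffun !card_ord /d expnS.
have := leq_mul2l K H.+1 (2 * H); rewrite (_ : H.+1 <= 2 * H)%N ?orbT; last by lia.
by set z := (H ^ d')%N; nia.
Qed.

Lemma orbit_mx_shift (h h' : 'I_d -> nat) k : (forall i, h i = h' i + k)%N ->
  orbit_mx c h = orbit_mx c h' *m A ^+ k.
Proof.
move=> hk; apply/matrixP => i j; rewrite mxE hk exprD.
rewrite (_ : shift_mx d c ^+ h' i * shift_mx d c ^+ k = A ^+ h' i *m A ^+ k) // [LHS]mxE [RHS]mxE.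
by apply: eq_bigr => l _; rewrite [orbit_mx _ _ _ _]mxE.
Qed.

(** Subtracting the least time divides the determinant by a power of det A, so an independent tuple
    of the window becomes an anchored one that is still independent. *)
Lemma few_multiples N K H p x (s : seq nat) : independence_bound d' c N K -> (H <= N)%N ->
  prime p -> p \notin bad_primes H -> (0 < x)%N ->
  uniq s -> {in s, forall n, (x <= n < x + H)%N /\ (p %| `|u n|)%N} -> (size s <= K)%N.
Proof.
move=> indep leHN pr_p pbad x0 Us sx; rewrite leqNgt; apply/negP => ltK.
have [|h [hs hH dh]] := window_independent (x := x) indep leHN Us _ ltK.
  by move=> n /sx[].
pose j0 : 'I_d := [arg min_(j < ord0) h j]; pose h' i := (h i - h j0)%N.
have hmin i : (h j0 <= h i)%N by rewrite /j0; case: arg_minnP => // j _; apply.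
have hE i : h i = (h' i + h j0)%N by rewrite /h' subnK.
have dh' : \det (orbit_mx c h') != 0.
  by move: dh; rewrite (orbit_mx_shift hE) det_mulmx mulf_eq0 negb_or => /andP[].
have [g gE] : exists g : {ffun 'I_d' -> 'I_H}, h' =1 anchored (j0, g).
  have lt k : (h' (lift j0 k) < H)%N by apply: leq_ltn_trans (leq_subr _ _) (hH _).
  exists [ffun k => Ordinal (lt k)] => i; rewrite /anchored /=.
  by case: unliftP => [j ->|->]; rewrite ?ffunE //= /h' subnn.
have orbE : orbit_mx c h' = orbit_mx c (anchored (j0, g)).
  by apply/matrixP => i j; rewrite !mxE gE.
move: pbad; rewrite !mem_cat !negb_or => /and3P[pD pDelta /flattenP pdet].
have x'0 : (0 < x + h j0)%N by rewrite addn_gt0 x0.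
have : (p%:Z %| orbit_const u c h')%Z.
  apply: (dvd_orbit_const rec x'0).
    rewrite coprimezE /= prime_coprime //; apply: contraNN pD => dv.
    by rewrite mem_primes pr_p D_gt0.
  by move=> i; rewrite dvdzE -addnA [(h j0 + _)%N]addnC -hE; case: (sx _ (hs i)).
rewrite dvdzE abszM Euclid_dvdM // => /orP[dv|dv]; last first.
  by move: pDelta; rewrite mem_primes pr_p dv absz_gt0 (det_hankel_neq0 lin).
apply: pdet; exists (primes `|\det (orbit_mx c (anchored (j0, g)))|).
  by apply: (map_f (fun k => primes `|\det (orbit_mx c (anchored k))|)); rewrite mem_enum.
by rewrite -orbE mem_primes pr_p dv absz_gt0 dh'.
Qed.

(** This covers bad primes too, as long as they do not divide det A: a power of p dividing d
    independent terms divides [orbit_const], hence is at most 2^(kap (z + 1)). *)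
Lemma few_heavy : exists kap, forall N K p x z (s : seq nat),
  independence_bound d' c N K -> (z <= N)%N -> prime p -> p \notin primes D -> (0 < x)%N ->
  uniq s -> {in s, forall n, (x <= n < x + z)%N} ->
  {in s, forall n, (kap * (z + 1) < trunc_log 2 p * logn p `|u n|)%N} -> (size s <= K)%N.
Proof.
have [kap [kap1 _ _ ocK _]] := size_bounds rec.
exists kap => N K p x z s indep lezN pr_p pD x0 Us sx heavy.
rewrite leqNgt; apply/negP => ltK.
have [h [hs hz dh]] := window_independent indep lezN Us sx ltK.
pose l := trunc_log 2 p; pose k := (kap * (z + 1) %/ l).+1.
have l0 : (0 < l)%N by apply: trunc_log_max; rewrite ?expn1 ?prime_gt1.
have oc0 := orbit_const_neq0 lin d'_gt0 dh.
have : ((p ^ k)%N%:Z %| orbit_const u c h)%Z.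
  apply: (dvd_orbit_const rec x0).
    rewrite coprimezE /= coprimeXl // prime_coprime //; apply: contraNN pD => dv.
    by rewrite mem_primes pr_p D_gt0.
  move=> i; rewrite dvdzE /=; have [u0|u0] := posnP `|u (x + h i)|%N.
    by rewrite u0 dvdn0.
  rewrite pfactor_dvdn // /k ltn_divLR // [X in (_ < X)%N]mulnC.
  by apply: heavy.
rewrite dvdzE /= => /dvdn_leq; rewrite absz_gt0 => /(_ oc0); apply/negP; rewrite -ltnNge.
apply: (@leq_ltn_trans (2 ^ (kap * z.+1))).
  apply: leq_trans (ocK h z _) _; first by move=> i; apply: ltnW.
  by rewrite expnM leq_exp2r // ltnW // ltn_expl.
apply: (@leq_trans ((2 ^ l) ^ k)).
  by rewrite -expnM ltn_exp2l // [(l * _)%N]mulnC -[z.+1]addn1; apply: ltn_ceil.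
by rewrite leq_exp2r // trunc_logP // prime_gt0.
Qed.

End BadPrimes.

(** * Summing weights over dyadic scales *)

Lemma count_dyadic (P : pred nat) (s : seq nat) K x y i : uniq s ->
  {in s, forall n, (x <= n < x + y)%N} ->
  (forall x' s', (x <= x')%N -> uniq s' -> {subset s' <= s} ->
     {in s', forall n, (x' <= n < x' + 2 ^ i)%N} -> {in s', forall n, P n} -> (size s' <= K)%N) ->
  (size [seq n <- s | P n] <= (y %/ 2 ^ i).+1 * K)%N.
Proof.
move=> Us sx few; have i0 : (0 < 2 ^ i)%N by rewrite expn_gt0.
pose f n : 'I_(y %/ 2 ^ i).+1 := inord ((n - x) %/ 2 ^ i).
rewrite -[X in (X * K)%N]card_ord; apply: (count_fibers (f := f)) => t.
have mem_s n : n \in [seq n <- [seq n <- s | P n] | f n == t] -> [/\ n \in s, P n & f n = t].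
  by rewrite !mem_filter => /and3P[/eqP].
apply: (few (x + 2 ^ i * t)%N); first exact: leq_addr.
- by rewrite !filter_uniq.
- by move=> n /mem_s[].
- move=> n /mem_s[ns _ ft]; have := sx n ns => /andP[lexn ltn].
  have : ((n - x) %/ 2 ^ i = t)%N.
    by rewrite -ft /f inordK // ltnS leq_div2r //; lia.
  have := divn_eq (n - x) (2 ^ i); have := ltn_pmod (n - x) i0.
  set q := ((n - x) %/ _)%N; set r := ((n - x) %% _)%N => lt_r e qt.
  by rewrite -qt mulnC; move: e lt_r; set z := (q * _)%N => e lt_r; lia.
- by move=> n /mem_s[].
Qed.

(** If i is the largest scale whose condition holds, then w <= kap (2^(i + 1) + 1), which the term
    of index i and 2 kap already cover. *)
Lemma dyadic_layers (w kap J : nat) : (w <= kap * (2 ^ J + 1))%N ->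
  (w <= 2 * kap + \sum_(i < J) (2 * kap * 2 ^ i) * (kap * (2 ^ i + 1) < w))%N.
Proof.
elim: J => [|J IHJ]; first by rewrite expn0 big_ord0; lia.
rewrite big_ord_recr /= => le; have [/IHJ le1|gt] := leqP w (kap * (2 ^ J + 1)).
  by apply: leq_trans le1 _; rewrite leq_add2l leq_addr.
apply: leq_trans le _; rewrite muln1 expnS; set S := (\sum_(_ < _) _)%N; nia.
Qed.

(** Scale i contributes O(kap 2^i) for each of at most (y / 2^i + 1) K terms, so each of the log y
    scales costs O(kap K y). *)
Lemma sum_dyadic_le (w : nat -> nat) (s : seq nat) kap K x y : uniq s -> (0 < y)%N ->
  {in s, forall n, (x <= n < x + y)%N} ->
  {in s, forall n, (w n <= kap * (2 ^ up_log 2 y + 1))%N} ->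
  (forall i x' s', (i < up_log 2 y)%N -> (x <= x')%N -> uniq s' -> {subset s' <= s} ->
     {in s', forall n, (x' <= n < x' + 2 ^ i)%N} ->
     {in s', forall n, (kap * (2 ^ i + 1) < w n)%N} -> (size s' <= K)%N) ->
  (\sum_(n <- s) w n <= 2 * kap * y + 4 * kap * K * up_log 2 y * y)%N.
Proof.
move=> Us y0 sx wle few; set J := up_log 2 y in wle few *.
have szs : (size s <= y)%N.
  rewrite -(size_iota x y); apply: uniq_leq_size => // n /sx.
  by rewrite mem_iota.
apply: (@leq_trans (\sum_(n <- s) (2 * kap + \sum_(i < J) (2 * kap * 2 ^ i) * (kap * (2 ^ i + 1) < w n)%N))).
  by rewrite big_seq [leqRHS]big_seq; apply: leq_sum => n ns; apply/dyadic_layers/wle.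
rewrite big_split /= big_const_seq count_predT iter_addn_0; apply: leq_add.
  by rewrite leq_mul2l szs orbT.
rewrite exchange_big /=.
apply: (@leq_trans (\sum_(i < J) 4 * kap * K * y)%N); last first.
  by rewrite sum_nat_const card_ord; apply: eq_leq; ring.
apply: leq_sum => i _; rewrite -big_distrr /=.
have -> : (\sum_(n <- s) (kap * (2 ^ i + 1) < w n) = size [seq n <- s | (kap * (2 ^ i + 1) < w n)])%N.
  by rewrite -sum1_size big_filter [RHS]big_mkcond; apply: eq_bigr => n _; case: ifP.
have le1 : (size [seq n <- s | (kap * (2 ^ i + 1) < w n)] <= (y %/ 2 ^ i).+1 * K)%N.
  apply: (count_dyadic (x := x)) => // x' s' lex Us' s's win heavy.
  exact: (few i x' s').
have le2 : (2 ^ i * (y %/ 2 ^ i).+1 <= 2 * y)%N.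
  rewrite mulnS addnC mul2n -addnn leq_add //; first by rewrite mulnC leq_divM.
  have y1 : (1 < y)%N.
    rewrite ltnNge; apply/negP => y1; have : (0 < J)%N by apply: leq_ltn_trans (ltn_ord i).
    by rewrite /J; have /eqP-> : up_log 2 y == 0%N by rewrite up_log_eq0 y1 orbT.
  have /andP[lt _] := up_log_bounds (isT : (1 < 2)%N) y1.
  by apply: leq_trans (ltnW lt); rewrite leq_pexp2l // -ltnS prednK ?(leq_ltn_trans _ (ltn_ord i)).
apply: leq_trans (leq_mul (leqnn _) le1) _.
have -> : (2 * kap * 2 ^ i * ((y %/ 2 ^ i).+1 * K) = 2 * kap * K * (2 ^ i * (y %/ 2 ^ i).+1))%N by ring.
have -> : (4 * kap * K * y = 2 * kap * K * (2 * y))%N by ring.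
by rewrite leq_mul2l le2 orbT.
Qed.

(** * Counting terms all of whose primes are bad *)

Section Poor.
Variables (C : numClosedFieldType) (d' : nat).
Let d := d'.+1.
Variables (u : nat -> int) (c : nat -> int) (al : 'I_d -> C).
Hypothesis archi : forall x : C, exists n : nat, `|x| <= n%:R.
Hypothesis lin : linear_recurrence u d c.
Hypothesis spec : nondegenerate_spectrum c al.
Hypothesis d'_gt0 : (0 < d')%N.
Let A := shift_mx d c.
Let D := `|\det A|%N.

Definition poor H n :=
  (u n != 0) && all (fun p => p \in bad_primes d' u c H) (primes `|u n|).

Lemma bad_primes_prime H p : p \in bad_primes d' u c H -> prime p.
Proof.
have pr n : p \in primes n -> prime p by rewrite mem_primes => /andP[].
by rewrite !mem_cat => /or3P[/pr|/pr|/flattenP[_ /mapP[k _ ->] /pr]].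
Qed.

Let wt p n := (trunc_log 2 p * logn p `|u n|)%N.
Let free_bad H : seq nat := undup [seq p <- bad_primes d' u c H | p \notin primes D].

(** The factor 2 pays for rounding the logarithm down: p < 2^(trunc_log 2 p + 1), and that logarithm
    is at least 1. *)
Lemma free_part_weight H n : poor H n ->
  (free_part D `|u n| <= 2 ^ (2 * \sum_(p <- free_bad H) wt p n))%N.
Proof.
move=> /andP[u0 /allP bad].
apply: (@leq_trans (\prod_(p <- free_bad H) p ^ logn p `|u n|)%N).
  rewrite [leqRHS](bigID (fun p => p \in primes `|u n|)) /=.
  rewrite /free_part -[leqLHS]muln1; apply: leq_mul; last first.
    rewrite big_seq_cond; apply: prodn_cond_gt0 => p /andP[pb _].
    have pr_p : prime p by move: pb; rewrite mem_undup mem_filter => /andP[_ /bad_primes_prime].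
    by rewrite expn_gt0 prime_gt0.
  rewrite -big_filter -[leqRHS]big_filter; apply/eq_leq/perm_big/uniq_perm.
  - by rewrite filter_uniq ?primes_uniq.
  - by rewrite filter_uniq ?undup_uniq.
  move=> p; rewrite !mem_filter mem_undup mem_filter [RHS]andbC -andbA; congr andb.
  have [pn|//] := boolP (p \in primes _); last by rewrite andbF.
  by rewrite andbT bad.
rewrite big_distrr /= expn_sum big_seq [leqRHS]big_seq; apply: leq_prod => p.
rewrite mem_undup mem_filter => /andP[_ /bad_primes_prime pr_p].
rewrite /wt mulnA expnM; have [->|v0] := posnP (logn p `|u n|); first by rewrite !expn0.
rewrite leq_exp2r //; have l0 : (0 < trunc_log 2 p)%N by apply: trunc_log_max; rewrite ?expn1 ?prime_gt1.
apply: leq_trans (ltnW (trunc_log_ltn p (isT : (1 < 2)%N))) _.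
by rewrite leq_pexp2l //; lia.
Qed.

(** Poor terms with a small part prime to det A, or heavy at some bad prime on the scale of the
    whole window, are few. Each remaining term has total weight at least x / (2 Q), while one bad
    prime spends only O(K y log y) on the window, and y <= x. *)
Lemma window_poor : exists Q X0 B : nat, (0 < Q)%N /\ forall N K H x y (s : seq nat),
  independence_bound d' c N K -> (0 < K)%N -> (0 < y <= N)%N -> (Q * y <= x)%N -> (X0 < x)%N ->
  uniq s -> {in s, forall n, (x <= n < x + y)%N /\ poor H n} ->
  (size s <= B * K * (size (bad_primes d' u c H)).+1 * (up_log 2 y).+1)%N.
Proof.
have [Q [X0 [B0 [Q0 few_small]]]] := few_small_free_parts archi lin spec d'_gt0.
have [kap few_heavyK] := few_heavy lin spec d'_gt0.
exists Q, X0, (B0 + 1 + 8 * Q * kap)%N; split => // N K H x y s indep K0 /andP[y0 leyN] leQy ltX0 Us sx.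
set m0 := size (bad_primes _ _ _ _); set J := up_log 2 y; pose S := free_bad H.
have Sm : (size S <= m0)%N.
  by apply: leq_trans (size_undup _) _; rewrite size_filter count_size.
have x0 : (0 < x)%N by apply: leq_ltn_trans ltX0.
have Sin p : p \in S -> prime p /\ p \notin primes D.
  by rewrite mem_undup mem_filter => /andP[pD /bad_primes_prime].
pose P1 n := (free_part D `|u n| ^ Q < 2 ^ x)%N.
pose P2 p n := (kap * (y + 1) < wt p n)%N.
pose P3 n := ~~ P1 n && all (fun p => ~~ P2 p n) S.
have split_s : (size s <= size [seq n <- s | P1 n] + \sum_(p <- S) size [seq n <- s | P2 p n]
     + size [seq n <- s | P3 n])%N.
  have szE (P : pred nat) : size [seq n <- s | P n] = (\sum_(n <- s) P n)%N.
    by rewrite -sum1_size big_filter big_mkcond; apply: eq_bigr => n _; case: (P n).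
  rewrite -sum1_size !szE; under [X in (_ + X + _)%N]eq_bigr => p _ do rewrite szE.
  rewrite exchange_big -!big_split /=; apply: leq_sum => n _.
  rewrite /P3; have [//|_ /=] := boolP (P1 n); rewrite add0n.
  have [//|/allPn[p pS /negPn P2p]] := boolP (all _ S); first by rewrite addn1.
  by rewrite addn0 (big_rem p) //= P2p.
have le1 : (size [seq n <- s | P1 n] <= B0 * K)%N.
  apply: (few_small N K x y) => //; first by rewrite filter_uniq.
    by move=> n; rewrite mem_filter => /andP[_ /sx[]].
  by move=> n; rewrite mem_filter => /andP[P1n /sx[_ /andP[]]].
have le2 : (\sum_(p <- S) size [seq n <- s | P2 p n] <= m0 * K)%N.
  apply: (@leq_trans (\sum_(p <- S) K)%N); last first.
    by rewrite big_const_seq count_predT iter_addn_0 mulnC leq_mul2r Sm orbT.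
  rewrite big_seq [leqRHS]big_seq; apply: leq_sum => p /Sin[pr_p pD].
  apply: (few_heavyK N K p x y) => //; first by rewrite filter_uniq.
    by move=> n; rewrite mem_filter => /andP[_ /sx[]].
  by move=> n; rewrite mem_filter => /andP[].
set s3 := [seq n <- s | P3 n] in split_s *.
have s3s n : n \in s3 -> [/\ n \in s, ~~ P1 n & all (fun p => ~~ P2 p n) S].
  by rewrite mem_filter => /andP[/andP[? ?] ?].
have leyx : (y <= x)%N by apply: leq_trans leQy; rewrite leq_pmull.
have weight n : n \in s3 -> (x <= 2 * Q * \sum_(p <- S) wt p n)%N.
  move=> /s3s[ns nP1 _]; have [_ poor_n] := sx n ns.
  have le' : (free_part D `|u n| ^ Q <= (2 ^ (2 * \sum_(p <- S) wt p n)) ^ Q)%N.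
    by rewrite leq_exp2r // free_part_weight.
  move: nP1; rewrite -leqNgt => /leq_trans/(_ le').
  by rewrite -expnM leq_exp2l // mulnAC.
have sum_w p : p \in S -> (\sum_(n <- s3) wt p n <= 2 * kap * y + 4 * kap * K * J * y)%N.
  move=> pS; have [pr_p pD] := Sin p pS.
  apply: (sum_dyadic_le (x := x)) => //; first by rewrite filter_uniq.
  - by move=> n /s3s[/sx[]].
  - move=> n /s3s[_ _ /allP/(_ p pS)]; rewrite -leqNgt => /leq_trans; apply.
    by rewrite leq_mul2l leq_add2r up_logP ?orbT.
  move=> i x' s' ltiJ lexx' Us' s's win heavy.
  have le2y : (2 ^ i <= y)%N.
    have y1 : (1 < y)%N.
      rewrite ltnNge; apply/negP => y1; move: ltiJ.
      by have /eqP-> : up_log 2 y == 0%N by rewrite up_log_eq0 y1 orbT.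
    have /andP[lt _] := up_log_bounds (isT : (1 < 2)%N) y1.
    by apply: leq_trans (ltnW lt); rewrite leq_pexp2l // -ltnS prednK ?(leq_ltn_trans _ ltiJ).
  apply: (few_heavyK N K p x' (2 ^ i)%N) => //; first exact: leq_trans leyN.
  exact: leq_trans lexx'.
have le3 : (size s3 * x <= 8 * Q * kap * K * m0 * J.+1 * x)%N.
  apply: (@leq_trans (\sum_(n <- s3) 2 * Q * \sum_(p <- S) wt p n)%N).
    rewrite -sum1_size big_distrl /= big_seq [leqRHS]big_seq; apply: leq_sum => n ns.
    by rewrite mul1n weight.
  rewrite -big_distrr exchange_big /=.
  apply: (@leq_trans (2 * Q * (\sum_(p <- S) (2 * kap * y + 4 * kap * K * J * y)))%N).
    by rewrite leq_mul2l big_seq [leqRHS]big_seq leq_sum ?orbT.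
  rewrite big_const_seq count_predT iter_addn_0.
  apply: (@leq_trans (2 * Q * ((4 * kap * K * J.+1 * x) * m0))%N); last by apply: eq_leq; ring.
  rewrite leq_mul2l; apply/orP; right; apply: leq_mul => //.
  apply: (@leq_trans (4 * kap * K * J.+1 * y)); last by rewrite leq_mul2l leyx orbT.
  rewrite -mulnDl leq_mul2r; apply/orP; right; rewrite mulnS leq_add2r.
  by apply: leq_trans (leq_pmulr _ K0); rewrite leq_mul2r orbT.
rewrite leq_pmul2r // in le3.
apply: leq_trans split_s _; apply: leq_trans (leq_add (leq_add le1 le2) le3) _.
have -> : ((B0 + 1 + 8 * Q * kap) * K * m0.+1 * J.+1 = B0 * K * (m0.+1 * J.+1)
  + m0.+1 * K * J.+1 + 8 * Q * kap * K * m0.+1 * J.+1)%N by ring.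
apply: leq_add; first apply: leq_add.
- exact: leq_pmulr.
- by apply: leq_trans (leq_pmulr _ (ltn0Sn J)); rewrite leq_mul2r leqnSn orbT.
by rewrite leq_mul2r leq_mul2l leqnSn !orbT.
Qed.

(* Beyond a constant, an interval is covered by logarithmically many windows
   [x, x + x / Q), indexed by the dyadic scale of x and the position in it. *)
Lemma poor_count : exists B R : nat, (1 < R)%N /\ forall N K H M (s : seq nat),
  independence_bound d' c (R * N) K -> (0 < K)%N -> (0 < N)%N -> (0 < H)%N ->
  uniq s -> {in s, forall n, (M < n <= M + N)%N /\ poor H n} ->
  (size s <= B * K * H ^ d * ((up_log 2 (R * N)).+1 ^ 2))%N.
Proof.
have [Q [X0 [B [Q0 win]]]] := window_poor.
have [E sizeE] := size_bad_primes lin d'_gt0.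
pose R := (2 * Q + X0 + 2)%N; pose X1 := (X0 + Q + 1)%N.
exists (2 * X1 + 2 * (2 * Q).+1 * (B * E.+1))%N, R; split=> [|N K H M s indep].
  by rewrite /R addn2.
move=> K0 N0 H0 Us sx.
set J := up_log 2 (R * N).
pose F := (B * K * (size (bad_primes d' u c H)).+1 * J.+1)%N.
have leNR : (N <= R * N)%N by rewrite leq_pmull // /R; lia.
have leF y : (y <= R * N)%N -> (B * K * (size (bad_primes d' u c H)).+1 * (up_log 2 y).+1 <= F)%N.
  by move=> le; rewrite leq_mul2l ltnS leq_up_log ?orbT.
have Hd : (0 < H ^ d)%N by rewrite expn_gt0 H0.
have F_le : (F <= B * E.+1 * K * H ^ d * J.+1)%N.
  rewrite /F leq_mul2r; apply/orP; right.
  have -> : (B * E.+1 * K * H ^ d = B * K * (E.+1 * H ^ d))%N by ring.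
  rewrite leq_mul2l; apply/orP; right; apply: leq_ltn_trans (sizeE H H0) _.
  by rewrite mulSn -[ltnLHS]add0n ltn_add2r.
suff : (size s <= 2 * X1 + J.+1 * (2 * Q).+1 * F)%N.
  have eqn_ (a b k h j : nat) : ((a + b) * k * h * j = a * (k * h * j) + b * k * h * j)%N by ring.
  move/leq_trans; apply; rewrite eqn_; apply: leq_add.
    by rewrite leq_pmulr // !muln_gt0 K0 Hd.
  apply: leq_trans (leq_mul (leqnn _) F_le) _.
  have -> : (J.+1 * (2 * Q).+1 * (B * E.+1 * K * H ^ d * J.+1) =
    (2 * Q).+1 * (B * E.+1) * K * H ^ d * J.+1 ^ 2)%N by rewrite -mulnn; ring.
  by do 4![rewrite leq_mul2r; apply/orP; right]; rewrite leq_pmull.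
(* For M large the whole interval is one window; otherwise all its elements are at most R * N. In
   both cases the count depends on N alone, not on M. *)
have [big|small] := leqP (Q * N + X0) M.
  apply: (@leq_trans F); last first.
    by apply: leq_trans (leq_addl _ _); rewrite leq_pmull.
  apply: leq_trans (leF N leNR); apply: (win (R * N)%N K H M.+1 N) => //.
  - by rewrite N0.
  - by lia.
  - by lia.
have sR n : n \in s -> (n <= R * N)%N by move=> /sx[/andP[_ le] _]; rewrite /R; nia.
(* From 2 * X1 on, the dyadic scale exceeds [X1], so the windows are nonempty and start beyond
   [X0]. *)
pose big n := (2 * X1 <= n)%N.
have -> : size s = (size [seq n <- s | ~~ big n] + size [seq n <- s | big n])%N.
  by rewrite !size_filter addnC count_predC.
apply: leq_add.
  rewrite -[leqRHS](size_iota 0); apply: uniq_leq_size; first by rewrite filter_uniq.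
  by move=> n; rewrite mem_filter mem_iota /big -ltnNge => /andP[].
pose k n := trunc_log 2 n; pose w n := (2 ^ k n %/ Q)%N.
pose f n : 'I_J.+1 * 'I_(2 * Q).+1 := (inord (k n), inord ((n - 2 ^ k n) %/ w n)).
have -> : (J.+1 * (2 * Q).+1 = #|{: 'I_J.+1 * 'I_(2 * Q).+1}|)%N by rewrite card_prod !card_ord.
apply: (count_fibers (f := f)) => -[t1 t2].
set s' := [seq _ <- _ | _].
have s'P n : n \in s' -> [/\ n \in s, big n & f n = (t1, t2)].
  by rewrite !mem_filter => /and3P[/eqP].
have kP n : n \in s' -> [/\ (2 ^ k n <= n < 2 * 2 ^ k n)%N, (X1 < 2 ^ k n)%N, k n = t1,
    (0 < w n)%N & ((n - 2 ^ k n) %/ w n)%N = t2].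
  move=> /s'P[ns bign [e1 e2]].
  have n0 : (0 < n)%N by move: bign; rewrite /big /X1; lia.
  have /andP[le lt] := trunc_log_bounds (isT : (1 < 2)%N) n0.
  have lt' : (n < 2 * 2 ^ k n)%N by rewrite -expnS.
  have X1k : (X1 < 2 ^ k n)%N by move: bign; rewrite /big; lia.
  have wn0 : (0 < w n)%N by rewrite divn_gt0 // /X1; lia.
  have kJ : (k n < J.+1)%N.
    by rewrite ltnS /J; apply: leq_trans (leq_up_log 2 (sR n ns)); rewrite -(leq_exp2l (m := 2)) //; apply: leq_trans le _; apply: up_logP.
  split => //; [by rewrite le lt' | by rewrite -e1 inordK |].
  rewrite -e2 inordK // ltnS.
  have : (2 ^ k n <= 2 * Q * w n)%N.
    have := ltn_ceil (2 ^ k n) Q0; rewrite -/(w n) mulSn.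
    have : (Q <= w n * Q)%N by rewrite leq_pmull.
    by rewrite [(w n * Q)%N]mulnC -mulnA; lia.
  move=> le2; apply: leq_trans (leq_div2r (w n) (_ : _ <= 2 * Q * w n)%N) _; last by rewrite mulnK.
  by apply: leq_trans le2; lia.
have [->//|[n1 n1in]] : s' = [::] \/ exists n, n \in s'.
  by case: (s') => [|n r]; [left | right; exists n; rewrite mem_head].
have [n1s n1b _] := s'P n1 n1in; have [/andP[le1 lt1] X1k k1 w1 _] := kP n1 n1in.
have kE n : n \in s' -> k n = k n1 by move=> /kP[_ _ -> _ _].
have wE n : n \in s' -> w n = w n1 by move=> ns; rewrite /w kE.
apply: leq_trans (leF (w n1) _); last first.
  by apply: leq_trans (sR n1 n1s); apply: leq_trans le1; apply: leq_div.
apply: (win (R * N)%N K H (2 ^ k n1 + t2 * w n1)%N (w n1)) => //.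
- rewrite w1 /=; apply: leq_trans (sR n1 n1s); apply: leq_trans le1; apply: leq_div.
- by rewrite mulnC; apply: leq_trans (leq_divM _ _) (leq_addr _ _).
- by apply: leq_trans (leq_addr _ _); rewrite /X1 in X1k; lia.
- by rewrite !filter_uniq.
move=> n ns; have [/s'P[/sx[_ poorn] _ _] _] := (ns, ns); split => //.
have [/andP[le lt] _ _ _ e2] := kP n ns.
have := divn_eq (n - 2 ^ k n) (w n); rewrite e2 wE // kE // => e.
have := ltn_pmod (n - 2 ^ k n1) w1; set r := ((n - 2 ^ k n1) %% w n1)%N in e * => lt_r.
rewrite kE // in le; lia.
Qed.

End Poor.

(** * Exploring linear relations *)

(** m vectors have rank at most m, so m coordinates decide every relation; [p0] is the pivot of one
    elimination step. *)
Lemma spanning_coords (F : fieldType) m (f : 'I_m -> nat -> F) : exists2 P : seq nat, (size P <= m)%N &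
  forall k : 'I_m -> F, {in P, forall p, \sum_i k i * f i p = 0} ->
    forall p, \sum_i k i * f i p = 0.
Proof.
elim: m f => [|m IHm] f; first by exists [::] => // k _ p; rewrite big_ord0.
have [f0|/existsNP[p0 /eqP fp0]] := pselect (forall p, f ord0 p = 0).
  have [P szP spanP] := IHm (fun i => f (lift ord0 i)); exists P; first exact: leqW.
  move=> k kP p; rewrite big_ord_recl f0 mulr0 add0r.
  apply: (spanP (fun i => k (lift ord0 i))) => q qP.
  by have := kP q qP; rewrite big_ord_recl f0 mulr0 add0r.
pose r i := f (lift ord0 i) p0 / f ord0 p0.
have [P szP spanP] := IHm (fun i p => f (lift ord0 i) p - r i * f ord0 p).
exists (p0 :: P) => // k kP.
have k0 : k ord0 = - \sum_i k (lift ord0 i) * r i.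
  have := kP p0 (mem_head _ _); rewrite big_ord_recl => /eqP; rewrite addr_eq0 => /eqP e.
  apply: (mulIf fp0); rewrite e mulNr mulr_suml; congr (- _); apply: eq_bigr => i _.
  by rewrite -mulrA divfK.
have kE p : \sum_i k i * f i p = \sum_i k (lift ord0 i) * (f (lift ord0 i) p - r i * f ord0 p).
  rewrite big_ord_recl k0 mulNr mulr_suml addrC -sumrB; apply: eq_bigr => i _.
  by rewrite [RHS]mulrBr; congr (_ - _); rewrite -mulrA.
move=> p; rewrite kE; apply: (spanP (fun i => k (lift ord0 i))) => q qP.
by rewrite -kE kP // inE qP orbT.
Qed.

Section Explore.
Variables (y : nat -> nat -> int) (W : seq nat).

Lemma span_exists : { span : seq nat -> seq nat | forall l, (size (span l) <= size l)%N /\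
  forall k : 'I_(size l) -> int, {in span l, forall p, \sum_i k i * y (nth 0%N l i) p = 0} ->
    forall p, \sum_i k i * y (nth 0%N l i) p = 0 }.
Proof.
suff /choice[span spanP] : forall l, exists P : seq nat, (size P <= size l)%N /\
  forall k : 'I_(size l) -> int, {in P, forall p, \sum_i k i * y (nth 0%N l i) p = 0} ->
    forall p, \sum_i k i * y (nth 0%N l i) p = 0 by exists span.
move=> l; have [P szP spanP] := spanning_coords (fun (i : 'I_(size l)) p => (y (nth 0%N l i) p)%:~R : rat).
exists P; split => // k kP p; apply/eqP; rewrite -(intr_eq0 rat) rmorph_sum /=.
under eq_bigr do rewrite intrM.
apply/eqP/(spanP (fun i => (k i)%:~R)) => q qP.
have := congr1 (intr : int -> rat) (kP q qP); rewrite rmorph_sum /= mulr0z => e.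
by rewrite -[RHS]e; apply: eq_bigr => i _; rewrite intrM.
Qed.

Let span := sval span_exists.

(* Kind 0 is a free choice, kind 1 a choice forced by the spanning set of the
   terms chosen so far, kind 2 a term with zero vector. *)
Definition candidates (kd : 'I_3) (l : seq nat) : seq nat :=
  if kd == 0 then W else
  if kd == 1 then [seq x <- W | has (fun p => y x p != 0) (span l)]
  else [seq x <- W | `[< forall p, y x p = 0 >]].

(** Lists are read from the tail: the head is the latest choice, constrained by the spanning set of
    the terms behind it. *)
Fixpoint explorations (ks : seq 'I_3) : seq (seq nat) :=
  if ks is kd :: ks' then
    flatten [seq [seq x :: l | x <- candidates kd l] | l <- explorations ks']
  else [:: [::]].

Lemma explorations_cons kd ks x l : x \in candidates kd l -> l \in explorations ks ->
  x :: l \in explorations (kd :: ks).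
Proof.
move=> xc lk; apply/flattenP; exists [seq z :: l | z <- candidates kd l].
  exact: (map_f (fun l => [seq z :: l | z <- candidates kd l])).
exact: (map_f (cons^~ l)).
Qed.

Lemma explorations_size ks l : l \in explorations ks -> size l = size ks.
Proof.
elim: ks l => [|kd ks IHks] l /=; first by rewrite inE => /eqP->.
by move=> /flattenP[_ /mapP[l' /IHks szl' ->] /mapP[x _ ->]] /=; rewrite szl'.
Qed.

(** A forced term is nonzero at one of at most s known coordinates, and each coordinate allows at
    most G terms. *)
Lemma size_explorations ks s G Q : (size ks <= s)%N ->
  (forall p, (size [seq x <- W | y x p != 0%R] <= G)%N) ->
  (size [seq x <- W | `[< forall p, y x p = 0 >]] <= Q)%N ->
  (size (explorations ks) <= size W ^ count (pred1 0%R) ks * (s * G) ^ count (pred1 1%R) ks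
     * Q ^ (size ks - count (pred1 0%R) ks - count (pred1 1%R) ks))%N.
Proof.
move=> szs WG WQ; elim: ks szs => [|kd ks IHks] // lts.
have {IHks} IHks := IHks (ltnW lts).
have candG l : size l = size ks -> (size (candidates 1%R l) <= s * G)%N.
  move=> szl; rewrite /candidates eqxx /=; have [szP _] := svalP span_exists l.
  apply: (@leq_trans (size (span l) * G)); last first.
    by rewrite leq_mul2r (leq_trans szP) ?orbT // szl ltnW.
  elim: (span l) => [|p P IHP] /=; first by rewrite filter_pred0.
  rewrite mulSn; apply: leq_trans (leq_add (WG p) IHP).
  rewrite !size_filter -count_predUI; apply: leq_trans (leq_addr _ _).
  by apply: sub_count => x.
have key B : (forall l, l \in explorations ks -> (size (candidates kd l) <= B)%N) ->
    (size (explorations (kd :: ks)) <= B * size (explorations ks))%N.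
  move=> candB; rewrite /= size_flatten /shape -map_comp sumnE big_map big_seq.
  apply: (@leq_trans (\sum_(l <- explorations ks | l \in explorations ks) B)%N).
    by apply: leq_sum => l lk /=; rewrite size_map candB.
  by rewrite -big_seq big_const_seq count_predT iter_addn_0 mulnC.
have cnt : (count (pred1 0%R) ks + count (pred1 1%R) ks <= size ks)%N.
  rewrite -count_predUI (_ : count (predI _ _) ks = 0%N) ?addn0 ?count_size //.
  by apply/eqP; rewrite -leqn0 leqNgt -has_count; apply/hasPn => x _ /=; case: eqP => // ->.
set a := count _ ks in cnt IHks *; set b := count _ ks in cnt IHks *.
rewrite [count (pred1 0%R) (kd :: ks)]/= [count (pred1 1%R) (kd :: ks)]/= -/a -/b [size (kd :: ks)]/=.
case: (eqVneq kd 0) key => [->|kd0] key.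
  rewrite (_ : (0 == 1 :> 'I_3) = false) // add0n add1n subSS expnS -!mulnA.
  by apply: leq_trans (key (size W) _) _ => //; rewrite leq_mul2l mulnA IHks orbT.
case: (eqVneq kd 1) key => [->|kd1] key.
  rewrite add0n add1n expnS.
  have -> : ((size ks).+1 - a - b.+1 = size ks - a - b)%N by lia.
  apply: leq_trans (key (s * G)%N _) _.
    by move=> l lk; apply: candG; apply: explorations_size.
  by rewrite [(size W ^ a * _)%N]mulnCA -[leqRHS]mulnA leq_mul2l IHks orbT.
rewrite !add0n; have -> : ((size ks).+1 - a - b = (size ks - a - b).+1)%N by lia.
rewrite expnS mulnCA.
apply: leq_trans (key Q _) _; last by rewrite leq_mul2l IHks orbT.
by move=> l _; rewrite /candidates (negbTE kd0) (negbTE kd1).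
Qed.

Section Relation.
Variables (I : finType) (v : I -> nat) (k : I -> int).
Hypothesis vW : forall i, v i \in W.
Hypothesis k_neq0 : forall i, k i != 0.
Hypothesis rel : forall p, \sum_i k i * y (v i) p = 0.

Definition closed_state (E : seq I) := forall p, \sum_(i <- E) k i * y (v i) p = 0.

(* A state that is not closed has a coordinate in its spanning set at which the
   partial relation fails, and some unexplored index must be nonzero there. *)
Lemma explore_exists m : (m <= #|I|)%N -> exists (E : seq I) (ks : seq 'I_3),
  [/\ uniq E, size E = m, size ks = m & [/\ map v E \in explorations ks,
    (count (pred1 0%R) ks <= (count (pred1 1%R) ks).+1)%N &
    closed_state E -> (count (pred1 0%R) ks <= count (pred1 1%R) ks)%N]].
Proof.
elim: m => [|m IHm] ltm; first by exists [::], [::].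
have [E [ks [UE szE szk [Ek le1 lec]]]] := IHm (ltnW ltm).
have [clE|nclE] := pselect (closed_state E).
  have [i iE] : exists i, i \notin E.
    apply: contrapT => /forallNP all_in; move: ltm; rewrite -szE ltnNge; case/negP.
    rewrite cardE; apply: uniq_leq_size; first exact: enum_uniq.
    by move=> i _; have /negP/negPn := all_in i.
  have [y0|ny0] := pselect (forall p, y (v i) p = 0).
    exists (i :: E), (inord 2 :: ks); split; rewrite /= ?iE ?szE ?szk //.
    have e0 : (inord 2 == 0 :> 'I_3) = false by rewrite -val_eqE /= inordK.
    have e1 : (inord 2 == 1 :> 'I_3) = false by rewrite -val_eqE /= inordK.
    rewrite e0 e1 !add0n; split => //; last by move=> _; apply: lec.
    apply: explorations_cons => //; rewrite /candidates e0 e1 mem_filter vW andbT.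
    exact/asboolP.
  exists (i :: E), (0 :: ks); split; rewrite /= ?iE ?szE ?szk //.
  split.
  - by apply: explorations_cons; rewrite /candidates ?eqxx.
  - by rewrite add1n add0n ltnS lec.
  (* A nonzero vector with nonzero coefficient cannot extend a closed state to a closed one, so the
     second inequality holds vacuously. *)
  move=> cl; case: ny0 => p; have := cl p; rewrite big_cons clE addr0 => /eqP.
  by rewrite mulf_eq0 (negbTE (k_neq0 i)) => /eqP.
have [j jE [p pS yp]] : exists2 j, j \notin E & exists2 p, p \in span (map v E) & y (v j) p != 0.
  apply: contrapT => nj; apply: nclE.
  have yj j p : j \notin E -> p \in span (map v E) -> y (v j) p = 0.
    move=> jE pS; apply/eqP; apply: contrapT => /negP yn.
    by apply: nj; exists j => //; exists p.
  have [_ spanE] := svalP span_exists (map v E).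
  have sumE p : \sum_(i <- E) k i * y (v i) p =
     \sum_(a < size (map v E)) k (tnth (in_tuple E) (cast_ord (size_map v E) a))
         * y (nth 0%N (map v E) a) p.
    rewrite (big_tnth _ _ E) (reindex (cast_ord (size_map v E))) /=; last first.
      by apply: onW_bij; exists (cast_ord (esym (size_map v E))) => a; rewrite ?cast_ordK ?cast_ordKV.
    apply: eq_bigr => a _; congr (_ * y _ p).
    rewrite (nth_map (tnth (in_tuple E) (cast_ord (size_map v E) a))) -?(size_map v E) //.
    by rewrite [in LHS](tnth_nth (tnth (in_tuple E) (cast_ord (size_map v E) a))).
  move=> p; rewrite sumE.
  apply: (spanE (fun a => k (tnth (in_tuple E) (cast_ord (size_map v E) a)))) => q qS.
  rewrite -sumE; have := rel q; rewrite (bigID (fun i => i \in E)) /=.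
  rewrite [X in _ + X]big1 ?addr0; last by move=> i iE; rewrite (yj i q) ?mulr0.
  by rewrite -big_uniq.
exists (j :: E), (1 :: ks); split; rewrite /= ?jE ?szE ?szk //.
split => //.
- apply: explorations_cons => //; rewrite /candidates /= mem_filter vW andbT.
  by apply/hasP; exists p.
- by rewrite add0n add1n; apply: leq_trans le1 _.
Qed.

End Relation.
(** When all indices are explored the state is closed, so free choices do not outnumber forced ones.
    The factors s^s and 3^s count orders of exploration and sequences of kinds; given both, the list
    of values determines the tuple. *)
Lemma count_relations s m (X : {set {ffun 'I_s -> 'I_m}}) G Q Bd :
  {in X, forall n : {ffun 'I_s -> 'I_m}, (forall i, (n i : nat) \in W) /\ exists k : 'I_s -> int,
     (forall i, k i != 0) /\ forall p, \sum_i k i * y (n i) p = 0} ->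
  (forall p, (size [seq x <- W | y x p != 0%R] <= G)%N) ->
  (size [seq x <- W | `[< forall p, y x p = 0 >]] <= Q)%N ->
  (forall f g q, (f + g + q = s)%N -> (f <= g)%N ->
     (size W ^ f * (s * G) ^ g * Q ^ q <= Bd)%N) ->
  (#|X| <= s ^ s * 3 ^ s * Bd)%N.
Proof.
move=> Xrel WG WQ WBd.
pose vals (n : {ffun 'I_s -> 'I_m}) (E : seq 'I_s) := [seq n i : nat | i <- E].
pose good (z : s.-tuple 'I_s * s.-tuple 'I_3) n :=
  [&& n \in X, uniq z.1, vals n z.1 \in explorations z.2 &
    (count (pred1 0%R) z.2 <= count (pred1 1%R) z.2)%N].
have good_exists n : n \in X -> [exists z, good z n].
  move=> nX; have [nW [k [k0 rel]]] := Xrel n nX.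
  have [|E [ks [UE szE szk [Ek _ lec]]]] := explore_exists (m := s) nW k0 rel.
    by rewrite card_ord.
  move/eqP: (szE) => szE'; move/eqP: (szk) => szk'.
  apply/existsP; exists (Tuple szE', Tuple szk'); rewrite /good nX UE Ek /=.
  apply: lec => p; rewrite -[RHS](rel p) big_uniq //=; apply: eq_bigl => i.
  have /subset_cardP/(_ (subset_predT _)) : #|E| = #|'I_s|.
    by rewrite card_ord (card_uniqP UE).
  by move=> ->.
have good_card z : (#|[set n | good z n]| <= Bd)%N.
  case: z => E ks; set Y := [set _ | _].
  have [-> | [n0]] := set_0Vmem Y; first by rewrite cards0.
  rewrite inE => /and4P[_ UE _ lec].
  have szE : size E = s by rewrite size_tuple.
  have Efull i : i \in (E : seq _).
    have /subset_cardP/(_ (subset_predT _)) : #|(E : seq 'I_s)| = #|'I_s|.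
      by rewrite card_ord (card_uniqP UE).
    by move=> ->.
  have vals_inj : injective (vals^~ E).
    move=> n n' /eq_in_map e; apply/ffunP => i; apply/val_inj; apply: e; exact: Efull.
  apply: (@leq_trans (size (explorations ks))).
    rewrite cardE -(size_map (vals^~ E)); apply: uniq_leq_size.
      by rewrite map_inj_uniq ?enum_uniq.
    by move=> l /mapP[n]; rewrite mem_enum inE => /and4P[_ _ nk _] ->.
  have szks : (size ks <= s)%N by rewrite size_tuple.
  apply: leq_trans (size_explorations szks WG WQ) _; apply: WBd => //.
  have cnt : (count (pred1 0%R) ks + count (pred1 1%R) ks <= size ks)%N.
    rewrite -count_predUI (_ : count (predI _ _) ks = 0%N) ?addn0 ?count_size //.
    by apply/eqP; rewrite -leqn0 leqNgt -has_count; apply/hasPn => x _ /=; case: eqP => // ->.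
  by move: cnt; rewrite size_tuple; lia.
have -> : (s ^ s * 3 ^ s * Bd = \sum_(z : s.-tuple 'I_s * s.-tuple 'I_3) Bd)%N.
  by rewrite sum_nat_const card_prod !card_tuple !card_ord.
apply: (@leq_trans (\sum_z #|[set n | good z n]|)%N); last by apply: leq_sum => z _.
apply: (@leq_trans (\sum_(n in X) \sum_z good z n)%N).
  rewrite -sum1_card; apply: leq_sum => n /good_exists/existsP[z gz].
  by rewrite (bigD1 z) //= gz.
rewrite exchange_big /=; apply: leq_sum => z _.
rewrite -sum1_card big_mkcond [leqRHS]big_mkcond; apply: leq_sum => n _.
by rewrite inE /good; case: (n \in X).
Qed.

End Explore.

(** * From multiplicative dependence to valuations *)

Lemma logn_prod_expn (I : finType) p (g : I -> nat) (a : I -> nat) : (forall i, (0 < g i)%N) ->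
  logn p (\prod_i g i ^ a i)%N = (\sum_i a i * logn p (g i))%N.
Proof.
move=> g0; pose h (x y : nat) := (0 < x)%N /\ logn p x = y.
suff [] : h (\prod_i g i ^ a i)%N (\sum_i a i * logn p (g i))%N by [].
apply: (big_ind2 h); first by rewrite /h logn1.
  by move=> x1 y1 x2 y2 [x10 <-] [x20 <-]; rewrite /h muln_gt0 x10 x20 lognM.
by move=> i _; rewrite /h expn_gt0 g0 lognX.
Qed.

Lemma valuation_relation (C : numClosedFieldType) (I : finType) (g k : I -> int) p :
  (forall i, g i != 0) -> \prod_i ((g i)%:~R : C) ^ k i = 1 ->
  \sum_i k i * (logn p `|g i|)%:Z = 0.
Proof.
move=> g0 prod1.
pose a i := if 0 <= k i then `|k i|%N else 0%N; pose b i := if 0 <= k i then 0%N else `|k i|%N.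
have kab i : k i = (a i)%:Z - (b i)%:Z.
  by rewrite /a /b; case: ifP => k0; lia.
have eC : \prod_i ((g i)%:~R : C) ^+ a i = \prod_i ((g i)%:~R : C) ^+ b i.
  rewrite -[RHS]mul1r -[X in _ = X * _]prod1 -big_split /=; apply: eq_bigr => i _.
  by rewrite !exprnP -expfzDr ?intr_eq0 // kab subrK.
have eZ : \prod_i g i ^+ a i = \prod_i g i ^+ b i.
  apply/(@intr_inj C); rewrite !rmorph_prod /=.
  by under eq_bigr do rewrite rmorphXn; under [RHS]eq_bigr do rewrite rmorphXn.
have := congr1 (fun x => logn p `|x|%N) eZ; rewrite !absz_prod.
under eq_bigr do rewrite abszX; under [in X in _ = X -> _]eq_bigr do rewrite abszX.
rewrite !logn_prod_expn; try by move=> i; rewrite absz_gt0.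
move/(congr1 Posz)/eqP; rewrite -!natz !natr_sum -subr_eq0 -sumrB => /eqP e.
rewrite -[RHS]e; apply: eq_bigr => i _.
by rewrite kab mulrBl !natz !PoszM.
Qed.

(** A zero exponent would make the support of k a proper sub-tuple that is still dependent. *)
Lemma max_rank_relation (C : numClosedFieldType) (I : finType) (g : I -> int) :
  mult_dependent_max_rank (fun i => (g i)%:~R : C) ->
  (forall i, g i != 0) /\ exists k : I -> int, (forall i, k i != 0) /\
    forall p, \sum_i k i * (logn p `|g i|)%:Z = 0.
Proof.
move=> [[g0 [k [[i0 ki0] prod1]]] sub].
have g0' i : g i != 0 by have := g0 i; rewrite intr_eq0.
split => //; exists k; split; last by move=> p; apply: valuation_relation prod1.
move=> i; apply: contraT => /negPn/eqP ki.
pose S := [set j | k j != 0].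
have Sin j : (j \in S) = (k j != 0) by rewrite inE.
case: (sub S).
- by apply/set0Pn; exists i0; rewrite Sin.
- by rewrite properEneq subsetT andbT; apply/eqP => ST; have := Sin i; rewrite ST inE ki eqxx.
split; first by move=> j; exact: g0.
exists (fun j => k (val j)); split.
  by exists (exist _ i0 (eq_ind_r is_true ki0 (Sin i0))).
rewrite -[RHS]prod1 (bigID (fun j => j \in S)) /= [X in _ = _ * X]big1 ?mulr1; last first.
  by move=> j; rewrite Sin negbK => /eqP->; rewrite expr0z.
by rewrite (big_sub (fun j => j \in S) (fun j => (g j)%:~R ^ k j)).
Qed.

Lemma complex_archimedean (R : realType) (x : R[i]) : exists n : nat, `|x| <= n%:R.
Proof.
exists (Num.truncn (Normc.normc x)).+1; rewrite -[`|x|]/((Normc.normc x)%:C).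
have -> : (Num.truncn (Normc.normc x)).+1%:R = (((Num.truncn (Normc.normc x)).+1%:R : R)%:C) :> R[i].
  by rewrite rmorph_nat.
by rewrite lecR ltW // -truncn_le_nat.
Qed.

(** * Asymptotics *)

Lemma leq_exp_pow2 m l : (l ^ m <= m ^ m * 2 ^ l)%N.
Proof.
have [->|m0] := posnP m; first by rewrite !expn0 mul1n expn_gt0.
have le1 : (l <= m * 2 ^ (l %/ m))%N.
  apply: ltnW; apply: leq_trans (ltn_ceil l m0) _.
  by rewrite mulnC leq_mul2l ltn_expl ?orbT.
apply: (@leq_trans ((m * 2 ^ (l %/ m)) ^ m)); first by rewrite leq_exp2r.
by rewrite expnMn -expnM leq_mul2l leq_pexp2l ?orbT // leq_divM.
Qed.

Lemma up_log_pow_le n t : (0 < n)%N -> ((up_log 2 n).+1 ^ t <= t ^ t * 4 * n)%N.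
Proof.
move=> n0; apply: leq_trans (leq_exp_pow2 _ _) _; rewrite -mulnA leq_mul2l; apply/orP; right.
have [n1|n1] := leqP n 1.
  by have -> : n = 1%N by [lia]; rewrite up_log1.
have /andP[lt _] := up_log_bounds (isT : (1 < 2)%N) n1.
have : (0 < up_log 2 n)%N by rewrite up_log_gt0.
by case: (up_log 2 n) lt => // k /=; rewrite !expnS; lia.
Qed.

Section Analytic.
Variables (R : realType) (d s B R1 c1 t : nat) (eps : R).
Hypothesis d_ge2 : (2 <= d)%N.
Hypothesis s_gt0 : (0 < s)%N.
Hypothesis t_gt0 : (0 < t)%N.
Hypothesis R1_gt0 : (0 < R1)%N.
Hypothesis t_eps : (3 * s + 1)%:R <= t%:R * eps.

Let del : R := 1 / (4 * d%:R - 3).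

(** A free, forced or zero index costs N to the power 1, 1 - 2 del or 1 - del; as f <= g, the total
    is at most s (1 - del). The rest is a constant times (K L^2)^s, whose t-th power is O(N^(3 s));
    the extra 1 in 3 s + 1 absorbs the constant once N >= N0. *)
Lemma analytic_bound : exists N0 : nat, forall N K : nat, (1 <= N)%N -> (N0 <= N)%N ->
  (0 < K)%N -> (K ^ t <= c1 * N)%N ->
  exists H Bd : nat, [/\ (0 < H)%N, (H <= 2 * N)%N,
    forall f g q, (f + g + q = s)%N -> (f <= g)%N ->
      (N ^ f * (s * ((N %/ H).+1 * K)) ^ g * (B * K * H ^ d * (up_log 2 (R1 * N)).+1 ^ 2) ^ q <= Bd)%N
    & (s ^ s * 3 ^ s * Bd)%:R <= N%:R `^ (s%:R * (1 - del) + eps)].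
Proof.
pose c2 := (t ^ t * 4 * R1)%N; pose c3 := (2 * s + B * 2 ^ d + 1)%N.
pose c4 := (s ^ s * 3 ^ s)%N.
exists (c4 ^ t * c3 ^ (s * t) * (c1 * c2 ^ 2) ^ s)%N => N K N1 N0N K0 Kt.
pose x : R := N%:R; have x1 : 1 <= x by rewrite /x ler1n.
have x0 : 0 < x by apply: lt_le_trans x1.
have xn0 : x != 0 by rewrite gt_eqF.
have dR : 2 <= d%:R :> R by rewrite (ler_nat R 2).
have den0 : 0 < 4 * d%:R - 3 :> R by lra.
have del0 : 0 < del by rewrite /del divr_gt0.
have deld : del * (4 * d%:R - 3) = 1 by rewrite /del divfK // gt_eqF.
have del5 : del <= 1/5.
  by rewrite /del ler_pdivrMr //; lra.
pose th := 2 * del.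
have xth1 : 1 <= x `^ th by rewrite -[leLHS](powRr0 x); apply: ler_powR => //; rewrite /th; lra.
have xthx : x `^ th <= x by rewrite -{2}[x](powRr1 (ltW x0)); apply: ler_powR => //; rewrite /th; lra.
pose H := (Num.truncn (x `^ th)).+1.
have Hgt : x `^ th < H%:R by rewrite /H -truncn_le_nat.
have Hle : H%:R <= 2 * x `^ th.
  have : (Num.truncn (x `^ th))%:R <= x `^ th by rewrite truncn_le powR_ge0.
  by rewrite /H -natr1; lra.
pose L := (up_log 2 (R1 * N)).+1; pose T := (K * L ^ 2)%N.
have T0 : (0 < T)%N by rewrite muln_gt0 K0.
pose a : R := c3%:R * T%:R.
have T1 : 1 <= T%:R :> R by rewrite ler1n.
have c31 : 1 <= c3%:R :> R by rewrite ler1n /c3 addn1.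
have a1 : 1 <= a by rewrite /a; apply: mulr_ege1.
have a0 : 0 <= a by apply: le_trans a1.
pose Z : R := a ^+ s * x `^ (s%:R * (1 - del)).
have Z0 : 0 <= Z by rewrite mulr_ge0 ?exprn_ge0 ?powR_ge0.
exists H, (Num.truncn Z); split=> //.
- by rewrite -(ler_nat R) natrM -/x; apply: le_trans Hle _; rewrite ler_pM2l.
- move=> f g q fgq lefg; rewrite truncn_ge_nat //.
  set X := (s * _)%N; set Y := (B * K * _ * _)%N.
  have F2 : X%:R <= a * x `^ (1 - th).
    have le1 : (N %/ H).+1%:R <= 2 * x `^ (1 - th).
      have one : 1 <= x `^ (1 - th) by rewrite -[leLHS](powRr0 x); apply: ler_powR => //; rewrite /th; lra.
      have : (N %/ H)%:R <= x `^ (1 - th).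
        rewrite powRB ?xn0 ?implybT // powRr1 ?(ltW x0) // ler_pdivlMr; last by apply: lt_le_trans xth1.
        apply: (@le_trans _ _ ((N %/ H)%:R * H%:R)); first by rewrite ler_wpM2l // (ltW Hgt).
        by rewrite -natrM ler_nat leq_divM.
      by rewrite -natr1; lra.
    have -> : X%:R = (N %/ H).+1%:R * (s * K)%N%:R :> R by rewrite -natrM /X mulnCA.
    apply: le_trans (ler_wpM2r _ le1) _ => //.
    rewrite [leLHS]mulrAC ler_wpM2r ?powR_ge0 // /a -!natrM ler_nat mulnA.
    apply: leq_mul; first by rewrite /c3 -addnA leq_addr.
    by rewrite /T leq_pmulr // expn_gt0.
  have F3 : Y%:R <= a * x `^ (1 - del).
    (* The comparison 2 d del <= 1 - del amounts to 2 d + 1 <= 4 d - 3, that is d >= 2. *)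
    have Hd : H%:R ^+ d <= 2 ^+ d * x `^ (1 - del).
      apply: le_trans (_ : (2 * x `^ th) ^+ d <= _).
        by apply: lerXn2r; rewrite ?nnegrE ?mulr_ge0 ?powR_ge0.
      rewrite exprMn ler_wpM2l ?exprn_ge0 // -powR_mulrn ?powR_ge0 // -powRrM.
      by apply: ler_powR => //; rewrite /th; lra.
    have -> : Y%:R = (B * K * L ^ 2)%N%:R * H%:R ^+ d :> R.
      by rewrite -natrX -natrM /Y mulnAC.
    apply: le_trans (ler_wpM2l _ Hd) _ => //.
    rewrite mulrA ler_wpM2r ?powR_ge0 // /a -!natrX -!natrM ler_nat.
    have -> : (B * K * L ^ 2 * 2 ^ d = B * 2 ^ d * T)%N by rewrite /T; ring.
    by rewrite leq_mul2r /c3 addnAC leq_addl orbT.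
  apply: le_trans (_ : x ^+ f * (a * x `^ (1 - th)) ^+ g * (a * x `^ (1 - del)) ^+ q <= _).
    rewrite natrM natrM !natrX -/x; apply: ler_pM; rewrite ?mulr_ge0 ?exprn_ge0 //.
      apply: ler_wpM2l; first by rewrite exprn_ge0 ?(ltW x0).
      by apply: lerXn2r; rewrite ?nnegrE ?mulr_ge0 ?powR_ge0.
    by apply: lerXn2r; rewrite ?nnegrE ?mulr_ge0 ?powR_ge0.
  have -> : x ^+ f * (a * x `^ (1 - th)) ^+ g * (a * x `^ (1 - del)) ^+ q =
     a ^+ (g + q) * x `^ (f%:R + (1 - th) * g%:R + (1 - del) * q%:R).
    rewrite !exprMn !exprD -!(powR_mulrn _ (powR_ge0 _ _)) -(powR_mulrn _ (ltW x0)) -!powRrM.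
    rewrite !powRD ?xn0 ?implybT //; ring.
  apply: ler_pM; rewrite ?exprn_ge0 ?powR_ge0 //.
    by apply: ler_weXn2l => //; rewrite -fgq -addnA leq_addl.
  apply: ler_powR => //.
  have sR : s%:R = f%:R + g%:R + q%:R :> R by rewrite -fgq !natrD.
  have fgR : f%:R <= g%:R :> R by rewrite ler_nat.
  have q0 : 0 <= q%:R :> R by [].
  rewrite sR /th; nra.
rewrite natrM; apply: le_trans (_ : c4%:R * Z <= _).
  by rewrite ler_wpM2l // truncn_le.
rewrite powRD ?xn0 ?implybT // -/x /Z mulrA mulrC ler_wpM2l ?powR_ge0 //.
rewrite -(@ler_pXn2r _ t) ?nnegrE ?mulr_ge0 ?exprn_ge0 ?powR_ge0 //.
apply: le_trans (_ : x ^+ (3 * s + 1) <= _); last first.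
  rewrite -!powR_mulrn ?powR_ge0 ?(ltW x0) // -powRrM; apply: ler_powR => //.
  by rewrite mulrC.
have Lt : (L ^ t <= c2 * N)%N.
  by apply: leq_trans (up_log_pow_le _ _) _; rewrite ?muln_gt0 ?R1_gt0 // /c2 !mulnA.
have Tt : (T ^ t <= c1 * c2 ^ 2 * N ^ 3)%N.
  rewrite /T expnMn expnAC; apply: leq_trans (leq_mul Kt (_ : _ <= (c2 * N) ^ 2)%N) _.
    by rewrite leq_exp2r.
  by apply: eq_leq; ring.
rewrite /a -!natrM -!natrX -!natrM -!natrX ler_nat.
have -> : ((c4 * (c3 * T) ^ s) ^ t = c4 ^ t * c3 ^ (s * t) * (T ^ t) ^ s)%N.
  by rewrite !expnMn -!expnM [(t * s)%N]mulnC mulnA.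
apply: (@leq_trans (c4 ^ t * c3 ^ (s * t) * (c1 * c2 ^ 2 * N ^ 3) ^ s)).
  by rewrite leq_mul2l leq_exp2r // Tt orbT.
by rewrite [((_ * N ^ 3) ^ s)%N]expnMn mulnA -[((N ^ 3) ^ s)%N]expnM addn1 [(N ^ _.+1)%N]expnS leq_mul2r N0N orbT.
Qed.

End Analytic.

Lemma independence_bound_exists (C : numClosedFieldType) d' (c : nat -> int)
  (al : 'I_d'.+1 -> C) t : nondegenerate_spectrum c al -> (0 < t)%N ->
  exists2 c0 : nat, (0 < c0)%N & forall N : nat, (0 < N)%N ->
    exists K : nat, [/\ (0 < K)%N, (K ^ t <= c0 * N)%N & independence_bound d' c N K].
Proof.
move=> spec t0; have [c0 c00 indep] := independent_times spec t0.
exists c0 => // N N0; pose P K := (K ^ t <= c0 * N)%N.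
have P1 : P 1%N by rewrite /P exp1n muln_gt0 c00.
have Pb K : P K -> (K <= c0 * N)%N.
  move=> PK; apply: leq_trans PK; have [->//|K0] := posnP K.
  by rewrite -{1}[K]expn1 leq_pexp2l.
(* K is the largest admissible value, so a set of more than K times violates the bound and
   [independent_times] applies to it. *)
case: (ex_maxnP (ex_intro _ 1%N P1) Pb) => K PK maxK; exists K; split => //; first exact: maxK.
move=> y s leyN Us sy ltK; apply: (indep y s) => //.
apply: (@leq_ltn_trans (c0 * N)); first by rewrite leq_mul2l leyN orbT.
rewrite ltnNge; apply/negP => le; have := maxK _ le; rewrite leqNgt ltK //.
Qed.

Section Count.
Variables (C : numClosedFieldType) (d' : nat).
Let d := d'.+1.
Variables (u : nat -> int) (c : nat -> int) (al : 'I_d -> C).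
Hypothesis archi : forall x : C, exists n : nat, `|x| <= n%:R.
Hypothesis lin : linear_recurrence u d c.
Hypothesis spec : nondegenerate_spectrum c al.
Hypothesis d'_gt0 : (0 < d')%N.

(** Bad primes get the value 0, so a relation between full valuation vectors passes to these, and
    the zero vectors are exactly the poor terms among nonzero ones. *)
Definition good_valuation H n p : int :=
  if prime p && (p \notin bad_primes d' u c H) then (logn p `|u n|)%:Z else 0.

Lemma few_multiples_interval N1 K H M N p (W : seq nat) :
  independence_bound d' c N1 K -> (0 < H <= N1)%N -> uniq W ->
  {in W, forall n, (M < n <= M + N)%N} ->
  (size [seq n <- W | good_valuation H n p != 0%R] <= (N %/ H).+1 * K)%N.
Proof.
move=> indep /andP[H0 leHN] UW W1.
have [/andP[pr_p pbad]|] := boolP (prime p && (p \notin bad_primes d' u c H)); last first.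
  by move=> np; rewrite /good_valuation (negbTE np) eqxx filter_pred0.
pose f n : 'I_(N %/ H).+1 := inord ((n - M.+1) %/ H).
rewrite -[X in (X * K)%N]card_ord; apply: (count_fibers (f := f)) => j.
apply: (few_multiples lin spec d'_gt0 indep leHN pr_p pbad (x := (M.+1 + j * H)%N)) => //.
  by rewrite !filter_uniq.
move=> n; rewrite !mem_filter => /and3P[/eqP fj nz nW]; have ltn := W1 n nW; split.
  have := ltn_pmod (n - M.+1) H0; have := divn_eq (n - M.+1) H.
  have -> : ((n - M.+1) %/ H = j)%N by rewrite -fj inordK // ltnS leq_div2r //; lia.
  by set z := (j * H)%N; set r := (_ %% _)%N; lia.
move: nz; rewrite /good_valuation pr_p pbad /= eqz_nat -lt0n logn_gt0 mem_primes.
by case/and3P.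
Qed.

Lemma count_max_rank_le : exists B R : nat, (1 < R)%N /\ forall s N K H M : nat,
  independence_bound d' c (R * N) K -> (0 < K)%N -> (0 < N)%N -> (0 < H <= R * N)%N ->
  forall Bd : nat, (forall f g q, (f + g + q = s)%N -> (f <= g)%N ->
    (N ^ f * (s * ((N %/ H).+1 * K)) ^ g * (B * K * H ^ d * (up_log 2 (R * N)).+1 ^ 2) ^ q <= Bd)%N) ->
  (count_max_rank C u s M N <= s ^ s * 3 ^ s * Bd)%N.
Proof.
have [B [R [R1 poorB]]] := poor_count archi lin spec d'_gt0.
exists B, R; split=> // s N K H M indep K0 N0 /andP[H0 leH] Bd le_Bd.
pose W := [seq n <- iota M.+1 N | u n != 0].
have UW : uniq W by rewrite filter_uniq ?iota_uniq.
have Win n : n \in W -> (M < n <= M + N)%N.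
  by rewrite mem_filter mem_iota => /andP[_]; rewrite addSn ltnS.
have szW : (size W <= N)%N by rewrite size_filter; apply: leq_trans (count_size _ _) _; rewrite size_iota.
apply: (@count_relations (good_valuation H) W s _ _ ((N %/ H).+1 * K)
   (B * K * H ^ d * (up_log 2 (R * N)).+1 ^ 2)).
- move=> n; rewrite inE => /andP[/forallP nM /asboolP/max_rank_relation[un0 [k [k0 rel]]]].
  split=> [i|].
    rewrite mem_filter un0 mem_iota /=; have := nM i; by rewrite addn1 => ->; rewrite addSn ltn_ord.
  exists k; split => // p; rewrite /good_valuation.
  case: (prime p && _); first exact: rel.
  by apply: big1 => i _; rewrite mulr0.
- by move=> p; apply: (few_multiples_interval (M := M) p indep); rewrite ?H0.
- apply: (poorB N K H M) => //; first by rewrite filter_uniq.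
  move=> n; rewrite mem_filter => /andP[/asboolP y0 nW]; split; first exact: Win.
  have un0 : u n != 0 by move: nW; rewrite mem_filter => /andP[].
  rewrite /poor un0; apply/allP => p; rewrite mem_primes => /and3P[pr_p un pd].
  apply: contraT => pbad; have := y0 p; rewrite /good_valuation pr_p pbad => /eqP.
  by rewrite eqz_nat -leqn0 leqNgt logn_gt0 mem_primes pr_p un pd.
move=> f g q fgq lefg; apply: leq_trans (le_Bd f g q fgq lefg).
rewrite !leq_mul2r; apply/orP; right; apply/orP; right.
by have [->|f0] := posnP f; rewrite ?expn0 // leq_exp2r.
Qed.

End Count.

Theorem theorem1p1 (R : realType) (u : nat -> int) (d : nat) (c : nat -> int)
    (s : nat) :
  linear_recurrence u d c ->
  (2 <= d)%N ->
  simple_recurrence R[i] d c ->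
  nondegenerate_recurrence R[i] d c ->
  (1 <= s)%N ->
  forall eps : R, 0 < eps ->
  exists N0 : nat, forall N M : nat, (1 <= N)%N -> (N0 <= N)%N ->
    (count_max_rank R[i] u s M N)%:R
      <= N%:R `^ (s%:R * (1 - 1 / (4 * d%:R - 3)) + eps).
Proof.
move=> lin d2 simp nondeg s1 eps eps0.
have [al spec] := spectrum_exists (ltnW d2) simp nondeg.
case: d d2 lin simp nondeg al spec => [//|d'] d2 lin simp nondeg al spec.
have archi := @complex_archimedean R.
have [B [R0 [R01 countB]]] := count_max_rank_le archi lin spec d2.
(* Per index, K and the squared logarithm lose at most N^(3 / t) up to constants; t makes the s
   losses and the constants fit into N^eps. *)
have [t [t0 t_eps]] : exists t : nat, (0 < t)%N /\ (3 * s + 1)%:R <= t%:R * eps.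
  exists (Num.truncn ((3 * s + 1)%:R / eps)).+1; split => //.
  by rewrite -ler_pdivrMr // ltW // -truncn_le_nat.
have [c0 c00 indepK] := independence_bound_exists spec t0.
have R0_gt0 : (0 < R0)%N := ltnW R01.
have [N0 boundN] := analytic_bound B (c0 * R0) d2 s1 t0 R0_gt0 t_eps.
exists N0 => N M N1 N0N.
have [|K [K0 Kt indep]] := indepK (R0 * N)%N; first by rewrite muln_gt0 R0_gt0.
rewrite mulnA in Kt; have [H [Bd [H0 leH le_Bd leR]]] := boundN N K N1 N0N K0 Kt.
apply: le_trans leR; rewrite ler_nat; apply: (countB s N K H M) => //.
by rewrite H0; apply: leq_trans leH _; rewrite leq_mul2r R01 orbT.
Qed.
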